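(* Let $\Sigma$ be a connected Riemann surface and $(\Lambda,\mathbf{k})$ a colour scheme. Then there is an isomorphism of fundamental groups $$\pi_1\,\mathsf{Div}^{\mathbf{k}}_+(\Sigma,\Lambda)\cong\pi_1\,\mathsf{Div}^{\mathbf{k}}_+(\Sigma,\mathrm{Sk}^1(\Lambda)),$$ where $\mathrm{Sk}^1(\Lambda)$ is the 1-skeleton of $\Lambda$.
   Context: A colour scheme $(\Lambda,\mathbf{k})$ consists of a (finite) simplicial complex $\Lambda$ with vertex set $\mathrm{Sk}^0(\Lambda)$ (vertices are called colours) and a nonzero function $\mathbf{k}:\mathrm{Sk}^0(\Lambda)\to\mathbb{N}_0$, $\lambda\mapsto k_\lambda$. For distinct vertices, $[\lambda_1;\dots;\lambda_\ell]$ denotes the simplex they span. Put $S^{\mathbf{k}}\Sigma=\prod_\lambda S^{k_\lambda}\Sigma$, where $S^k\Sigma=\Sigma^k/\mathfrak{S}_k$ is viewed as the space of effective divisors of degree $k$ on $\Sigma$. The space of effective divisors of degree $\mathbf{k}$ on $\Sigma$ braiding by $\Lambda$ is $$\mathsf{Div}^{\mathbf{k}}_+(\Sigma,\Lambda)=\Big\{\mathbf{d}=(d_\lambda)_\lambda\in S^{\mathbf{k}}\Sigma:\ [\lambda_1;\dots;\lambda_\ell]\notin\Lambda\Rightarrow\bigcap_{i=1}^{\ell}\mathrm{supp}(d_{\lambda_i})=\emptyset\Big\}.$$ The 1-skeleton $\mathrm{Sk}^1(\Lambda)$ is regarded as a 1-dimensional simplicial complex with the same vertices. *)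

(* Defs.v *)
From HB Require Import structures.
From mathcomp Require Import all_boot all_order all_algebra all_fingroup.
From mathcomp Require Import generic_quotient complex lra.
From mathcomp Require Import mathcomp_extra boolp classical_sets functions.
From mathcomp Require Import reals topology normedtype derive.
From mathcomp Require Import homotopy.

Set Implicit Arguments.
Unset Strict Implicit.
Unset Printing Implicit Defensive.

Import Order.TTheory GRing.Theory Num.Theory.
Import numFieldNormedType.Exports.

Local Open Scope classical_set_scope.
Local Open Scope ring_scope.
Local Open Scope quotient_scope.

Definition unit_interval (R : realType) : Type := `[0 : R, 1]%classic.

Section UnitInterval.
Variable R : realType.
Local Notation I := (unit_interval R).

HB.instance Definition _ := Topological.copy I (set_type (`[0 : R, 1]%classic)).

Definition ival (t : I) : R := \val t.

Lemma ival_continuous : continuous ival.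
Proof. exact: initial_continuous. Qed.

Lemma ival_itv (t : I) : 0 <= ival t <= 1.
Proof. by have := set_valP t; rewrite /= in_itv. Qed.

Lemma clamp_subproof (r : R) :
  Num.max 0 (Num.min r 1) \in (`[0 : R, 1]%classic : set R).
Proof.
by rewrite inE /= in_itv /= le_max lexx /= ge_max ler01 /= ge_min lexx orbT.
Qed.

(* The retraction of the real line onto the unit interval: it turns a real
   expression whose value is in [0, 1] into a parameter of a path. *)
Definition clamp (r : R) : I :=
  @exist R (fun t => t \in `[0 : R, 1]%classic) _ (clamp_subproof r).

Lemma ival_clamp (r : R) : 0 <= r <= 1 -> ival (clamp r) = r.
Proof.
by case/andP=> r0 r1; rewrite /ival /= (min_idPl r1) (max_idPr r0).
Qed.

Lemma clamp_ival (t : I) : clamp (ival t) = t.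
Proof. by apply: val_inj; exact: ival_clamp (ival_itv t). Qed.

Lemma clamp_continuous : continuous clamp.
Proof.
apply: continuous_comp_initial => r.
apply: (@continuous_max R R (cst 0) (idfun \min cst 1)); first exact: cvg_cst.
by apply: (@continuous_min R R idfun (cst 1)); [exact: cvg_id|exact: cvg_cst].
Qed.

Lemma unit_interval_neq : clamp 0 != clamp 1.
Proof.
apply/eqP => /(congr1 ival).
by rewrite !ival_clamp ?lexx ?ler01// => /eqP; rewrite eq_sym oner_eq0.
Qed.

HB.instance Definition _ := isBiPointed.Build I unit_interval_neq.

Lemma ival0 : ival zero = 0. Proof. by rewrite ival_clamp ?lexx ?ler01. Qed.
Lemma ival1 : ival one = 1. Proof. by rewrite ival_clamp ?lexx ?ler01. Qed.

End UnitInterval.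

Section Gluing.
Context {R : realType} {Z X : topologicalType}.

Lemma glue_continuous (u : Z -> R^o) (a : R) (f g : Z -> X) :
  continuous u -> continuous f -> continuous g ->
  (forall z, u z = a -> f z = g z) ->
  continuous (fun z => if u z <= a then f z else g z).
Proof.
move=> cu cf cg fg; apply/continuous_subspace_setT.
have -> : [set: Z] = u @^-1` [set r | r <= a] `|` u @^-1` [set r | a <= r].
  by apply/seteqP; split=> // z _ /=; case: (leP (u z) a) => [|/ltW]; [left|right].
have clu D : closed D -> closed (u @^-1` D).
  by move=> cD; apply: (preimage_closed _ cD) => z _; exact: cu.
apply: withinU_continuous; first by apply: clu; exact: closed_le.
- by apply: clu; exact: closed_ge.
- apply: (@subspace_eq_continuous _ _ _ f); last exact: continuous_subspaceT.
  by move=> z /set_mem /= uz; rewrite /from_subspace uz.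
- apply: (@subspace_eq_continuous _ _ _ g); last exact: continuous_subspaceT.
  move=> z /set_mem /= uz; rewrite /from_subspace; case: ifP => // uz'.
  by apply/esym/fg/le_anti; rewrite uz uz'.
Qed.

End Gluing.

Section ContinuityHelpers.
Context {R : realType} {T U V : topologicalType}.
Local Notation I := (unit_interval R).

Lemma cts_comp (f : T -> U) (g : U -> V) :
  continuous f -> continuous g -> continuous (fun t => g (f t)).
Proof. by move=> cf cg t; apply: (@continuous_comp _ _ _ f g); [exact: cf|exact: cg]. Qed.

Lemma cts_pair (f : T -> U) (g : T -> V) :
  continuous f -> continuous g -> continuous (fun t => (f t, g t)).
Proof. by move=> cf cg t; apply: (@cvg_pair _ _ _ (nbhs t) (nbhs (f t)) (nbhs (g t)) _ _ _ f g (cf t) (cg t)). Qed.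

Lemma cts_fst : continuous (fun z : T * U => z.1).
Proof. by move=> z; exact: cvg_fst. Qed.

Lemma cts_snd : continuous (fun z : T * U => z.2).
Proof. by move=> z; exact: cvg_snd. Qed.

Lemma cts_cst (x : U) : continuous (fun _ : T => x).
Proof. by move=> z; exact: cvg_cst. Qed.

Lemma cts_add (f g : T -> R^o) :
  continuous f -> continuous g -> continuous (fun t => f t + g t : R^o).
Proof. by move=> cf cg t; apply: cvgD; [exact: cf|exact: cg]. Qed.

Lemma cts_sub (f g : T -> R^o) :
  continuous f -> continuous g -> continuous (fun t => f t - g t : R^o).
Proof. by move=> cf cg t; apply: cvgB; [exact: cf|exact: cg]. Qed.

Lemma cts_mul (f g : T -> R^o) :
  continuous f -> continuous g -> continuous (fun t => f t * g t : R^o).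
Proof. by move=> cf cg t; apply: cvgM; [exact: cf|exact: cg]. Qed.

Lemma cts_clamp (f : T -> R^o) :
  continuous f -> continuous (fun t => clamp (f t)).
Proof.
by move=> cf t; apply: (@continuous_comp _ R^o _ f (@clamp R));
  [exact: cf|exact: clamp_continuous].
Qed.

Lemma cts_ival (f : T -> I) :
  continuous f -> continuous (fun t => ival (f t) : R^o).
Proof.
by move=> cf t; apply: (@continuous_comp _ _ R^o f (@ival R));
  [exact: cf|exact: ival_continuous].
Qed.

Lemma cts_min (f g : T -> R^o) :
  continuous f -> continuous g -> continuous (fun t => Num.min (f t) (g t) : R^o).
Proof.
by move=> cf cg t; apply: (@continuous_min R T f g); [exact: cf|exact: cg].
Qed.

End ContinuityHelpers.

Section Homotopy.
Context {R : realType} {X : topologicalType}.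
Local Notation I := (unit_interval R).
Implicit Types x y z : X.

Lemma cts_id (T : topologicalType) : continuous (fun t : T => t).
Proof. by move=> t; exact: cvg_id. Qed.

Ltac cts := cbv beta; lazymatch goal with
  | |- continuous (fun _ => ?c) => exact: cts_cst
  | |- continuous (fun t => (_, _)) => apply: cts_pair; cts
  | |- continuous (fun t => clamp _) => apply: cts_clamp; cts
  | |- continuous (fun t => ival _) => apply: cts_ival; cts
  | |- continuous (fun t => Num.min _ _) => apply: cts_min; cts
  | |- continuous (fun t => _ - _) => apply: cts_sub; cts
  | |- continuous (fun t => _ + _) => apply: cts_add; cts
  | |- continuous (fun t => _ * _) => apply: cts_mul; cts
  | |- continuous (fun t => t) => exact: cts_id
  | |- continuous (fun t => t.1) => exact: cts_fst
  | |- continuous (fun t => t.2) => exact: cts_snd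
  | |- continuous (fun t => t.1.1) => exact: (cts_comp cts_fst cts_fst)
  | |- continuous (fun t => t.1.2) => exact: (cts_comp cts_fst cts_snd)
  | |- continuous fst => exact: cts_fst
  | |- continuous snd => exact: cts_snd
  | |- continuous (@ival _) => exact: ival_continuous
  | _ => try eassumption
  end.

Definition concat_fun (f g : I -> X) (t : I) : X :=
  if ival t <= 2^-1 then f (clamp (2 * ival t)) else g (clamp (2 * ival t - 1)).

Lemma concat_continuous (Z : topologicalType) (u : Z -> R^o) (f g : Z * I -> X) :
  continuous u -> continuous f -> continuous g ->
  (forall w, u w = 2^-1 -> f (w, one) = g (w, zero)) ->
  continuous (fun w => if u w <= 2^-1 then f (w, clamp (2 * u w))
                       else g (w, clamp (2 * u w - 1))).
Proof.
move=> cu cf cg fg.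
apply: (@glue_continuous R Z X u 2^-1 (fun w => f (w, clamp (2 * u w)))
  (fun w => g (w, clamp (2 * u w - 1)))) => //.
- by apply: (cts_comp _ cf); cts.
- by apply: (cts_comp _ cg); cts.
- by move=> w uw; rewrite uw divff ?pnatr_eq0// subrr fg.
Qed.

Lemma concat_fun_continuous (f g : I -> X) : continuous f -> continuous g ->
  f one = g zero -> continuous (concat_fun f g).
Proof.
move=> cf cg fg; apply: (@concat_continuous I (@ival R)
  (fun wt => f wt.2) (fun wt => g wt.2)) => //.
- exact: ival_continuous.
- exact: (cts_comp cts_snd cf).
- exact: (cts_comp cts_snd cg).
Qed.

Lemma le01_half : 0 <= 2^-1 :> R. Proof. by rewrite invr_ge0 ler0n. Qed.

Lemma le1_half : (1 <= 2^-1 :> R) = false.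
Proof. by apply/negP => h; lra. Qed.

Lemma clamp21 : clamp (2 * 1 - 1) = one :> I.
Proof. by congr clamp; lra. Qed.

Section Concat.
Variables (x y z : X) (p : {path I from x to y in X}) (q : {path I from y to z in X}).

Lemma concat_cts : continuous (concat_fun p q).
Proof.
apply: concat_fun_continuous; [exact: cts_fun|exact: cts_fun|].
by rewrite path_one path_zero.
Qed.

Lemma concat0 : concat_fun p q zero = x.
Proof. by rewrite /concat_fun ival0 le01_half mulr0 path_zero. Qed.

Lemma concat1 : concat_fun p q one = z.
Proof. by rewrite /concat_fun ival1 le1_half clamp21 path_one. Qed.

Definition concat : {path I from x to z in X} :=
  mk_path concat_cts concat0 concat1.

End Concat.

Section Reverse.
Variables (x y : X) (p : {path I from x to y in X}).

Definition reverse_fun (f : I -> X) (t : I) : X := f (clamp (1 - ival t)).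

Lemma reverse_cts : continuous (reverse_fun p).
Proof.
apply: (@cts_comp _ _ _ (fun t => clamp (1 - ival t)) p); last exact: cts_fun.
by cts.
Qed.

Lemma reverse0 : reverse_fun p zero = y.
Proof. by rewrite /reverse_fun ival0 subr0 path_one. Qed.

Lemma reverse1 : reverse_fun p one = x.
Proof. by rewrite /reverse_fun ival1 subrr path_zero. Qed.

Definition reverse : {path I from y to x in X} :=
  mk_path reverse_cts reverse0 reverse1.

End Reverse.

Definition homotopic x y (p q : {path I from x to y in X}) : Prop :=
  exists H : I * I -> X, [/\ continuous H,
    forall t, H (zero, t) = p t, forall t, H (one, t) = q t,
    forall s, H (s, zero) = x & forall s, H (s, one) = y].

Lemma reparam_homotopic x y (p q : {path I from x to y in X}) (f : I -> X)
    (phi psi : I -> R^o) :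
  continuous f -> continuous phi -> continuous psi ->
  phi zero = psi zero -> phi one = psi one ->
  (forall t, p t = f (clamp (phi t))) -> (forall t, q t = f (clamp (psi t))) ->
  homotopic p q.
Proof.
move=> cf cphi cpsi e0 e1 pE qE.
exists (fun st => f (clamp ((1 - ival st.1) * phi st.2 + ival st.1 * psi st.2))).
split.
- apply: (cts_comp _ cf); cts.
  + exact: (cts_comp cts_snd cphi).
  + exact: (cts_comp cts_snd cpsi).
- by move=> t /=; rewrite ival0 subr0 mul1r mul0r addr0 pE.
- by move=> t /=; rewrite ival1 subrr mul1r mul0r add0r qE.
- by move=> s /=; rewrite e0 -mulrDl subrK mul1r -qE path_zero.
- by move=> s /=; rewrite e1 -mulrDl subrK mul1r -qE path_one.
Qed.

Lemma homotopic_refl x y (p : {path I from x to y in X}) : homotopic p p.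
Proof.
exists (fun st => p st.2); split => //.
- exact: (cts_comp cts_snd cts_fun).
- by move=> s /=; rewrite path_zero.
- by move=> s /=; rewrite path_one.
Qed.

Lemma homotopic_sym x y (p q : {path I from x to y in X}) :
  homotopic p q -> homotopic q p.
Proof.
case=> H [cH H0 H1 Hx Hy]; exists (fun st => H (clamp (1 - ival st.1), st.2)).
split => //.
- by apply: (cts_comp _ cH); cts.
- by move=> t /=; rewrite ival0 subr0 H1.
- by move=> t /=; rewrite ival1 subrr H0.
Qed.

Lemma homotopic_trans x y (p q r : {path I from x to y in X}) :
  homotopic p q -> homotopic q r -> homotopic p r.
Proof.
case=> H [cH H0 H1 Hx Hy] [K [cK K0 K1 Kx Ky]].
exists (fun st => if ival st.1 <= 2^-1 then H (clamp (2 * ival st.1), st.2)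
                  else K (clamp (2 * ival st.1 - 1), st.2)); split.
- apply: (@concat_continuous _ (fun st : I * I => ival st.1)
    (fun wt => H (wt.2, wt.1.2)) (fun wt => K (wt.2, wt.1.2))).
  + by cts.
  + by apply: (cts_comp _ cH); cts.
  + by apply: (cts_comp _ cK); cts.
  + by move=> st _ /=; rewrite H1 K0.
- by move=> t /=; rewrite ival0 le01_half mulr0 H0.
- by move=> t /=; rewrite ival1 le1_half clamp21 K1.
- by move=> s /=; case: ifP => _; rewrite ?Hx ?Kx.
- by move=> s /=; case: ifP => _; rewrite ?Hy ?Ky.
Qed.

Lemma concat_homotopic x y z (p p' : {path I from x to y in X})
    (q q' : {path I from y to z in X}) :
  homotopic p p' -> homotopic q q' -> homotopic (concat p q) (concat p' q').
Proof.
case=> H [cH H0 H1 Hx Hy] [K [cK K0 K1 Kx Ky]].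
exists (fun st => if ival st.2 <= 2^-1 then H (st.1, clamp (2 * ival st.2))
                  else K (st.1, clamp (2 * ival st.2 - 1))); split.
- apply: (@concat_continuous _ (fun st : I * I => ival st.2)
    (fun wt => H (wt.1.1, wt.2)) (fun wt => K (wt.1.1, wt.2))).
  + by cts.
  + by apply: (cts_comp _ cH); cts.
  + by apply: (cts_comp _ cK); cts.
  + by move=> st _ /=; rewrite Hy Kx.
- by move=> t /=; rewrite H0 K0.
- by move=> t /=; rewrite H1 K1.
- by move=> s /=; rewrite ival0 le01_half mulr0 Hx.
- by move=> s /=; rewrite ival1 le1_half clamp21 Ky.
Qed.

Lemma reverse_homotopic x y (p p' : {path I from x to y in X}) :
  homotopic p p' -> homotopic (reverse p) (reverse p').
Proof.
case=> H [cH H0 H1 Hx Hy]; exists (fun st => H (st.1, clamp (1 - ival st.2))).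
split => //.
- by apply: (cts_comp _ cH); cts.
- by move=> t /=; rewrite H0.
- by move=> t /=; rewrite H1.
- by move=> s /=; rewrite ival0 subr0 Hy.
- by move=> s /=; rewrite ival1 subrr Hx.
Qed.

Ltac minlra := rewrite [Num.min (_ + 4^-1) _]minEle; case: leP => ?;
  rewrite minEle; case: leP => ?; lra.

Lemma concatA x y z w (p : {path I from x to y in X})
    (q : {path I from y to z in X}) (r : {path I from z to w in X}) :
  homotopic (concat (concat p q) r) (concat p (concat q r)).
Proof.
pose phi (t : I) : R^o :=
  Num.min (2 * ival t) (Num.min (ival t + 4^-1) ((ival t + 1) * 2^-1)).
apply: (@reparam_homotopic _ _ _ _ (concat p (concat q r)) phi (@ival R)).
- exact: cts_fun.
- by rewrite /phi; cts.
- exact: ival_continuous.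
- by rewrite /phi /= ival0; minlra.
- by rewrite /phi /= ival1; minlra.
- move=> t; have /andP[t0 t1] := ival_itv t.
  rewrite /= /mk_path /concat_fun.
  have [t2|t2] := leP (ival t) 2^-1; last first.
    have -> : phi t = (ival t + 1) * 2^-1.
      by rewrite /phi; minlra.
    rewrite ival_clamp; last by lra.
    rewrite ifF; last by apply/negP => h; lra.
    rewrite ival_clamp; last by lra.
    rewrite ifF; last by apply/negP => h; lra.
    by congr (r (clamp _)); lra.
  rewrite ival_clamp; last by lra.
  have [t4|t4] := leP (2 * ival t) 2^-1.
    have -> : phi t = 2 * ival t.
      by rewrite /phi; minlra.
    by rewrite ival_clamp ?t4//; lra.
  have -> : phi t = ival t + 4^-1.
    by rewrite /phi; minlra.
  rewrite ival_clamp; last by lra.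
  rewrite ifF; last by apply/negP => h; lra.
  rewrite ival_clamp; last by lra.
  rewrite ifT; last lra.
  by congr (q (clamp _)); lra.
- by move=> t; rewrite clamp_ival.
Qed.

Lemma concat1p x y (p : {path I from x to y in X}) :
  homotopic (concat (cst x) p) p.
Proof.
apply: (@reparam_homotopic _ _ _ _ p
  (fun t => 1 - Num.min 1 (2 - 2 * ival t)) (@ival R)).
- exact: cts_fun.
- by cts.
- exact: ival_continuous.
- by rewrite ival0 minEle ifT; lra.
- by rewrite ival1 minEle ifF; [lra|apply/negP => h; lra].
- move=> t; have /andP[t0 t1] := ival_itv t.
  rewrite /= /mk_path /concat_fun minEle; case: ifP => ht.
    by rewrite ifT; [rewrite subrr path_zero|lra].
  by rewrite ifF; [congr (p (clamp _)); lra|apply/negP => h; lra].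
- by move=> t; rewrite clamp_ival.
Qed.

Lemma concatp1 x y (p : {path I from x to y in X}) :
  homotopic (concat p (cst y)) p.
Proof.
apply: (@reparam_homotopic _ _ _ _ p (fun t => Num.min (2 * ival t) 1) (@ival R)).
- exact: cts_fun.
- by cts.
- exact: ival_continuous.
- by rewrite ival0 minEle ifT; lra.
- by rewrite ival1 minEle ifF; [lra|apply/negP => h; lra].
- move=> t; have /andP[t0 t1] := ival_itv t.
  rewrite /= /mk_path /concat_fun minEle; case: ifP => ht.
    by rewrite ifT //; lra.
  by rewrite ifF; [rewrite path_one|apply/negP => h; lra].
- by move=> t; rewrite clamp_ival.
Qed.

Lemma concatpV x y (p : {path I from x to y in X}) :
  homotopic (concat p (reverse p)) (cst x).
Proof.
apply: (@reparam_homotopic _ _ _ _ p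
  (fun t => Num.min (2 * ival t) (2 - 2 * ival t)) (fun=> 0)).
- exact: cts_fun.
- by cts.
- by cts.
- by rewrite ival0 minEle ifT; lra.
- by rewrite ival1 minEle ifF; [lra|apply/negP => h; lra].
- move=> t; have /andP[t0 t1] := ival_itv t.
  rewrite /= /mk_path /concat_fun minEle.
  have [t2|t2] := leP (ival t) 2^-1; first by rewrite ifT //; lra.
  rewrite ifF; last by apply/negP => h; lra.
  rewrite /reverse /= /mk_path /reverse_fun ival_clamp; last by lra.
  by congr (p (clamp _)); lra.
- by move=> t; rewrite path_zero.
Qed.

Lemma concatVp x y (p : {path I from x to y in X}) :
  homotopic (concat (reverse p) p) (cst y).
Proof.
apply: (@reparam_homotopic _ _ _ _ p
  (fun t => 1 - Num.min (2 * ival t) (2 - 2 * ival t)) (fun=> 1)).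
- exact: cts_fun.
- by cts.
- by cts.
- by rewrite ival0 minEle ifT; lra.
- by rewrite ival1 minEle ifF; [lra|apply/negP => h; lra].
- move=> t; have /andP[t0 t1] := ival_itv t.
  rewrite /= /mk_path /concat_fun minEle.
  have [t2|t2] := leP (ival t) 2^-1.
    rewrite ifT; last lra.
    rewrite /reverse /= /mk_path /reverse_fun ival_clamp //; lra.
  rewrite ifF; last by apply/negP => h; lra.
  by congr (p (clamp _)); lra.
- by move=> t; rewrite path_one.
Qed.

End Homotopy.

Section FundamentalGroup.
Variables (R : realType) (X : topologicalType) (x : X).
Local Notation loop := {path unit_interval R from x to x in X}.

Definition loop_homotopic (p q : loop) : bool := `[< homotopic p q >].

Lemma loop_homotopic_refl : reflexive loop_homotopic.
Proof. by move=> p; apply/asboolP/homotopic_refl. Qed.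

Lemma loop_homotopic_sym : symmetric loop_homotopic.
Proof. by move=> p q; apply/asboolP/asboolP; exact: homotopic_sym. Qed.

Lemma loop_homotopic_trans : transitive loop_homotopic.
Proof.
move=> q p r /asboolP pq /asboolP qr; apply/asboolP.
exact: homotopic_trans pq qr.
Qed.

Canonical loop_equiv := EquivRel loop_homotopic
  loop_homotopic_refl loop_homotopic_sym loop_homotopic_trans.

Definition pi1 : Type := {eq_quot loop_equiv}.

HB.instance Definition _ := EqQuotient.on pi1.
HB.instance Definition _ := Choice.on pi1.

Lemma pi1P (p q : loop) : \pi_pi1 p = \pi_pi1 q <-> homotopic p q.
Proof. by split=> [/eqmodP/asboolP//|h]; apply/eqmodP/asboolP. Qed.

Lemma pi1_repr (p : loop) : homotopic (repr (\pi_pi1 p)) p.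
Proof. by apply/pi1P; rewrite reprK. Qed.

Definition pi1_one : pi1 := \pi_pi1 (cst x : loop).
Definition pi1_mul (a b : pi1) : pi1 := \pi_pi1 (concat (repr a) (repr b)).
Definition pi1_inv (a : pi1) : pi1 := \pi_pi1 (reverse (repr a)).

Lemma pi1_mulE (p q : loop) :
  pi1_mul (\pi_pi1 p) (\pi_pi1 q) = \pi_pi1 (concat p q).
Proof. by apply/pi1P/concat_homotopic; exact: pi1_repr. Qed.

Lemma pi1_invE (p : loop) : pi1_inv (\pi_pi1 p) = \pi_pi1 (reverse p).
Proof. by apply/pi1P/reverse_homotopic; exact: pi1_repr. Qed.

Lemma pi1_mulA : associative pi1_mul.
Proof.
elim/quotW=> p; elim/quotW=> q; elim/quotW=> r;
rewrite (pi1_mulE q r) (pi1_mulE p q) 2!pi1_mulE.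
by apply/esym/pi1P; exact: concatA.
Qed.

Lemma pi1_mul1 : left_id pi1_one pi1_mul.
Proof. by elim/quotW=> p; rewrite pi1_mulE; apply/pi1P; exact: concat1p. Qed.

Lemma pi1_mulr1 : right_id pi1_one pi1_mul.
Proof. by elim/quotW=> p; rewrite pi1_mulE; apply/pi1P; exact: concatp1. Qed.

Lemma pi1_mulV : left_inverse pi1_one pi1_inv pi1_mul.
Proof.
by elim/quotW=> p; rewrite pi1_invE pi1_mulE; apply/pi1P; exact: concatVp.
Qed.

Lemma pi1_mulrV : right_inverse pi1_one pi1_inv pi1_mul.
Proof.
by elim/quotW=> p; rewrite pi1_invE pi1_mulE; apply/pi1P; exact: concatpV.
Qed.

HB.instance Definition _ := isGroup.Build pi1
  pi1_mulA pi1_mul1 pi1_mulr1 pi1_mulV pi1_mulrV.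

End FundamentalGroup.

Definition group_isomorphic (G H : groupType) : Prop :=
  exists f : {multiplicative G -> H}, bijective f.

Section RiemannSurface.
Variable R : realType.
Local Notation C := (R[i]^o).

(* Only the values of [chart_map] on [chart_dom] and those of [chart_inv] on
   [chart_img] are meaningful. *)
Record complex_chart (T : topologicalType) := ComplexChart {
  chart_dom : set T;
  chart_map : T -> C;
  chart_inv : C -> T;
  chart_img := chart_map @` chart_dom;
  chart_dom_open : open chart_dom;
  chart_img_open : open chart_img;
  chart_mapK : {in chart_dom, cancel chart_map chart_inv};
  chart_map_continuous : {within chart_dom, continuous chart_map};
  chart_inv_continuous : {within chart_img, continuous chart_inv}
}.

(* The scalar field of the normed module C is R[i], so a derivative in the
   direction 1 is a complex derivative. *)
Definition holomorphic_on (U : set C) (f : C -> C) : Prop :=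
  forall z, U z -> derivable f z 1.

Definition holomorphic_compatible (T : topologicalType)
    (c d : complex_chart T) : Prop :=
  holomorphic_on (chart_map c @` (chart_dom c `&` chart_dom d))
    (chart_map d \o chart_inv c).

(* Second countability is not required: it is automatic for a connected Riemann
   surface, by Rado's theorem. *)
Record riemann_surface := RiemannSurface {
  rs_space :> topologicalType;
  rs_hausdorff : hausdorff_space rs_space;
  rs_atlas : set (complex_chart rs_space);
  rs_atlas_cover : forall p : rs_space, exists2 c, rs_atlas c & chart_dom c p;
  rs_atlas_compatible : forall c d, rs_atlas c -> rs_atlas d ->
    holomorphic_compatible c d
}.

End RiemannSurface.

Section SymmetricPower.
Variables (k : nat) (T : topologicalType).
Local Notation tuples := {ptws 'I_k -> T}.

Definition perm_rel (x y : tuples) : bool :=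
  `[< exists s : 'S_k, forall i, y i = x (s i) >].

Lemma perm_rel_refl : reflexive perm_rel.
Proof. by move=> x; apply/asboolP; exists 1%g => i; rewrite perm1. Qed.

Lemma perm_rel_sym : symmetric perm_rel.
Proof.
suff sub x y : perm_rel x y -> perm_rel y x.
  by move=> x y; apply/idP/idP; exact: sub.
move=> /asboolP[s ys]; apply/asboolP; exists (s^-1)%g => i.
by rewrite ys permKV.
Qed.

Lemma perm_rel_trans : transitive perm_rel.
Proof.
move=> y x z /asboolP[s ys] /asboolP[t zt]; apply/asboolP.
by exists (t * s)%g => i; rewrite permM zt ys.
Qed.

Canonical perm_equiv :=
  EquivRel perm_rel perm_rel_refl perm_rel_sym perm_rel_trans.

Definition sympow := {eq_quot perm_equiv}.

HB.instance Definition _ := Topological.copy sympow (quotient_topology sympow).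
HB.instance Definition _ := Quotient.on sympow.

(* [supp] does not depend on the representative, see [supp_pi]. *)
Definition supp (d : sympow) : set T := range (repr d).

Lemma supp_pi (x : tuples) : supp (\pi_sympow x) = range x.
Proof.
have /eqmodP/asboolP[s xs] : \pi_sympow (repr (\pi_sympow x)) = \pi_sympow x.
  exact: reprK.
apply/seteqP; split=> [_ [i _ <-]|_ [i _ <-]].
  by exists ((s^-1)%g i) => //; rewrite xs permKV.
by exists (s i).
Qed.

End SymmetricPower.

(* A simplex is identified with its nonempty set of vertices; every element of
   [V] is a vertex. *)
Record simplicial_complex (V : finType) := SimplicialComplex {
  simplices : {set {set V}};
  simplex_neq0 : finset.set0 \notin simplices;
  simplex_vertex : forall v, [set v]%SET \in simplices;
  simplex_sub : forall s t : {set V},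
    s \in simplices -> t \subset s -> t != finset.set0 -> t \in simplices
}.

Section Skeleton.
Variables (V : finType) (L : simplicial_complex V).

Definition sk1_simplices := [set s in simplices L | #|s| <= 2]%N%SET.

Lemma sk1_neq0 : finset.set0 \notin sk1_simplices.
Proof. by rewrite inE (negPf (simplex_neq0 L)). Qed.

Lemma sk1_vertex v : [set v]%SET \in sk1_simplices.
Proof. by rewrite inE simplex_vertex cards1. Qed.

Lemma sk1_sub (s t : {set V}) :
  s \in sk1_simplices -> t \subset s -> t != finset.set0 -> t \in sk1_simplices.
Proof.
rewrite !inE => /andP[sL s2] ts t0; rewrite (simplex_sub sL ts t0) /=.
exact: leq_trans (subset_leq_card ts) s2.
Qed.

Definition sk1 : simplicial_complex V :=
  SimplicialComplex sk1_neq0 sk1_vertex sk1_sub.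

End Skeleton.

Record colour_scheme (V : finType) := ColourScheme {
  cs_complex : simplicial_complex V;
  cs_mult : V -> nat;
  cs_mult_neq0 : exists v, cs_mult v != 0%N
}.

Section BraidingDivisors.
Variables (V : finType) (k : V -> nat) (T : topologicalType).

Definition sympow_prod : topologicalType :=
  prod_topology (fun v => sympow (k v) T : topologicalType).

Definition braiding_divisors (L : simplicial_complex V) : set sympow_prod :=
  [set d | forall s : {set V}, s != finset.set0 -> s \notin simplices L ->
           \bigcap_(v in [set` s]) supp (d v) = set0].

Definition div_plus (L : simplicial_complex V) : topologicalType :=
  set_type (braiding_divisors L).

End BraidingDivisors.

(* Main.v *)
From HB Require Import structures.
Require Import Defs.
From mathcomp Require Import all_boot all_order all_algebra all_fingroup.
From mathcomp Require Import generic_quotient complex ring lra zify.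
From mathcomp Require Import mathcomp_extra boolp classical_sets functions.
From mathcomp Require Import reals topology normedtype.
From mathcomp Require Import homotopy.

(** The space Y of divisors braiding by the 1-skeleton is obtained from the
    space X of divisors braiding by the complex by forbidding coincidences of
    points of three colours, a condition of real codimension 4.  It therefore
    suffices to see that every point of X has arbitrarily small open
    neighbourhoods U such that U, in X, and the intersection of U with Y, in Y,
    are path connected and have at most one homotopy class of paths between two
    points: paths and homotopies in X are then pushed into Y cell by cell along
    a fine subdivision.

    For U take the divisors whose points stay in small disjoint discs, each
    identified with the plane, around the points of a given divisor.  A
    configuration c of labelled points whose coordinates depend only on the
    colour and the disc is invariant under the permutations of the labels, so
    that the straight-line contraction to c descends to U.  A path in U and Y is
    locally homotopic to the image of a segment of labelled configurations.  The
    triangle spanned by such a segment and c meets none of the forbidden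
    subspaces, of real codimension 4, when c is generic; hence every path from x
    to y is homotopic to the contraction path from x to c followed by the reverse
    of the one from y to c.  Taking c on a curve on which no nonzero linear form
    involved vanishes identically, "generic" means "outside the zeros of a nonzero
    polynomial in one variable".  With codimension 2 instead of 4, the same
    argument shows that U meets Y in a path-connected set. *)

Set Implicit Arguments.
Unset Strict Implicit.
Unset Printing Implicit Defensive.

Import Order.TTheory GRing.Theory Num.Theory.
Import numFieldNormedType.Exports.

Local Open Scope classical_set_scope.
Local Open Scope ring_scope.
Local Open Scope quotient_scope.

(** * Homotopies of paths inside a set *)

Ltac cts := cbv beta; lazymatch goal with
  | |- continuous (fun _ => ?c) => exact: cts_cst
  | |- continuous (fun t => (_, _)) => apply: cts_pair; cts
  | |- continuous (fun t => clamp _) => apply: cts_clamp; cts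
  | |- continuous (fun t => ival _) => apply: cts_ival; cts
  | |- continuous (fun t => Num.min _ _) => apply: cts_min; cts
  | |- continuous (fun t => _ - _) => apply: cts_sub; cts
  | |- continuous (fun t => _ + _) => apply: cts_add; cts
  | |- continuous (fun t => _ * _) => apply: cts_mul; cts
  | |- continuous (fun t => t) => exact: cts_id
  | |- continuous (fun t => t.1) => exact: cts_fst
  | |- continuous (fun t => t.2) => exact: cts_snd
  | |- continuous (fun t => t.1.1) => exact: (cts_comp cts_fst cts_fst)
  | |- continuous (fun t => t.1.2) => exact: (cts_comp cts_fst cts_snd)
  | |- continuous (pair _) => apply: cts_pair; cts
  | |- continuous fst => exact: cts_fst
  | |- continuous snd => exact: cts_snd
  | |- continuous (@ival _) => exact: ival_continuous
  | _ => try eassumption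
  end.

Section Lifting.
Context {T : topologicalType} (A : set T).

Lemma val_continuous : continuous (\val : set_type A -> T).
Proof. exact: initial_continuous. Qed.

Lemma lift_continuous (Z : topologicalType) (f : Z -> T) :
  continuous f -> (forall z, A (f z)) ->
  exists2 g : Z -> set_type A, continuous g & forall z, \val (g z) = f z.
Proof.
move=> cf Af; exists (fun z => exist (fun x => x \in A) (f z) (mem_set (Af z))) => //.
exact: continuous_comp_initial.
Qed.

Lemma lift_point x : A x -> exists x' : set_type A, \val x' = x.
Proof. by move=> Ax; exists (exist (fun x => x \in A) x (mem_set Ax)). Qed.

End Lifting.

Section Paths.
Context {R : realType} {T : topologicalType}.
Local Notation I := (unit_interval R).
Implicit Types (A B : set T) (f g h : I -> T) (x y z : T).

(** Paths are plain functions into [T], not elements of a dependent type of paths, so that one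
    function can be a path in several subsets and its ends can be rewritten freely. *)
Definition is_path A f x y :=
  [/\ continuous f, forall t, A (f t), f zero = x & f one = y].

Definition homot A f g := exists H : I * I -> T,
  [/\ continuous H, forall w, A (H w), forall t, H (zero, t) = f t,
      forall t, H (one, t) = g t &
      forall s, H (s, zero) = f zero /\ H (s, one) = f one].

Lemma is_pathS A B f x y : A `<=` B -> is_path A f x y -> is_path B f x y.
Proof. by move=> AB [cf Af f0 f1]; split=> // t; exact: AB. Qed.

Lemma homotS A B f g : A `<=` B -> homot A f g -> homot B f g.
Proof. by move=> AB [H [cH AH H0 H1 H2]]; exists H; split=> // t; exact: AB. Qed.

Lemma is_path_ends A f x y : is_path A f x y -> A x /\ A y.
Proof. by case=> _ Af <- <-; split; exact: Af. Qed.

Lemma lift_path A f (x y : set_type A) : is_path A f (\val x) (\val y) ->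
  exists p : {path I from x to y in set_type A}, forall t, \val (p t) = f t.
Proof.
case=> cf Af f0 f1; have [g cg gf] := lift_continuous cf Af.
have g0 : g zero = x by apply: val_inj; rewrite gf.
have g1 : g one = y by apply: val_inj; rewrite gf.
by exists (mk_path cg g0 g1).
Qed.

Lemma val_path A (x y : set_type A) (p : {path I from x to y in set_type A}) :
  is_path A (fun t => \val (p t)) (\val x) (\val y).
Proof.
split=> [|t||]; rewrite ?path_zero ?path_one//; last exact: set_valP.
by apply: cts_comp; [exact: cts_fun|exact: val_continuous].
Qed.

(** Through this bridge the groupoid laws proved for paths of a subspace carry over to [homot]. *)
Lemma homot_val A (x y : set_type A) (p q : {path I from x to y in set_type A}) :
  homot A (fun t => \val (p t)) (fun t => \val (q t)) <-> homotopic p q.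
Proof.
split=> [[H [cH AH H0 H1 H2]]|[H [cH H0 H1 Hx Hy]]].
  have [K cK KH] := lift_continuous cH AH.
  exists K; split=> // t; apply: val_inj; rewrite KH ?H0 ?H1//.
    by have [-> _] := H2 t; rewrite path_zero.
  by have [_ ->] := H2 t; rewrite path_one.
exists (fun w => \val (H w)); split=> [|w|t|t|s].
- by apply: cts_comp; [exact: cH|exact: val_continuous].
- exact: set_valP.
- by rewrite H0.
- by rewrite H1.
- by rewrite Hx Hy path_zero path_one.
Qed.

Lemma homot_ends A f g : homot A f g -> f zero = g zero /\ f one = g one.
Proof.
case=> H [_ _ H0 H1 H2]; have [<- <-] := H2 one.
by rewrite !H1.
Qed.

Lemma homot_paths A f g x y : is_path A f x y -> homot A f g -> is_path A g x y.
Proof.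
move=> [cf Af f0 f1] fg; have [e0 e1] := homot_ends fg.
case: fg => H [cH AH H0 H1 H2]; split; rewrite -?e0 -?e1//.
  have -> : g = fun t => H (one, t) by apply/funext => t; rewrite H1.
  by apply: (cts_comp _ cH); cts.
by move=> t; rewrite -H1.
Qed.

Lemma homot_refl A f x y : is_path A f x y -> homot A f f.
Proof.
case=> cf Af f0 f1; exists (fun w => f w.2); split=> //.
exact: (cts_comp cts_snd cf).
Qed.

Lemma homot_sym A f g : homot A f g -> homot A g f.
Proof.
move=> fg; have [e0 e1] := homot_ends fg; case: fg => H [cH AH H0 H1 H2].
exists (fun st => H (clamp (1 - ival st.1), st.2)); split=> //=.
- by apply: (cts_comp _ cH); cts.
- by move=> t; rewrite ival0 subr0 H1.
- by move=> t; rewrite ival1 subrr H0.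
- by move=> s; have [-> ->] := H2 (clamp (1 - ival s)).
Qed.

Lemma homot_trans A g f h : homot A f g -> homot A g h -> homot A f h.
Proof.
move=> fg; have [e0 e1] := homot_ends fg.
case: fg => H [cH AH H0 H1 H2] [K [cK AK K0 K1 K2]].
exists (fun st => if ival st.1 <= 2^-1 then H (clamp (2 * ival st.1), st.2)
                  else K (clamp (2 * ival st.1 - 1), st.2)); split.
- apply: (@concat_continuous R T _ (fun st : I * I => ival st.1)
    (fun wt => H (wt.2, wt.1.2)) (fun wt => K (wt.2, wt.1.2))).
  + by cts.
  + by apply: (cts_comp _ cH); cts.
  + by apply: (cts_comp _ cK); cts.
  + by move=> st _ /=; rewrite H1 K0.
- by move=> w; case: ifP.
- by move=> t /=; rewrite ival0 le01_half mulr0 H0.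
- by move=> t /=; rewrite ival1 le1_half clamp21 K1.
- move=> s /=; case: ifP => _; first by have [-> ->] := H2 (clamp (2 * ival s)).
  by have [-> ->] := K2 (clamp (2 * ival s - 1)); rewrite e0 e1.
Qed.

Lemma is_path_cat A f g x y z : is_path A f x y -> is_path A g y z ->
  is_path A (concat_fun f g) x z.
Proof.
move=> [cf Af f0 f1] [cg Ag g0 g1]; split.
- by apply: concat_fun_continuous => //; rewrite f1 g0.
- by move=> t; rewrite /concat_fun; case: ifP.
- by rewrite /concat_fun ival0 le01_half mulr0.
- by rewrite /concat_fun ival1 le1_half clamp21.
Qed.

Lemma is_path_cst A x : A x -> is_path A (fun=> x) x x.
Proof. by move=> Ax; split=> //; exact: cts_cst. Qed.

Lemma is_path_rev A f x y : is_path A f x y -> is_path A (reverse_fun f) y x.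
Proof.
move=> [cf Af f0 f1]; split=> //.
- by apply: (@cts_comp _ _ _ (fun t : I => clamp (1 - ival t)) f) => //; cts.
- by move=> t; exact: Af.
- by rewrite /reverse_fun ival0 subr0.
- by rewrite /reverse_fun ival1 subrr.
Qed.

Lemma val_concat A (x y z : set_type A) (p : {path I from x to y in set_type A})
    (q : {path I from y to z in set_type A}) :
  (fun t => \val (concat p q t)) =
  concat_fun (fun t => \val (p t)) (fun t => \val (q t)).
Proof. by apply/funext => t; rewrite /concat_fun /= /mk_path /concat_fun; case: ifP. Qed.

Ltac lift_ends H x' y' :=
  have [/lift_point[x' ?] /lift_point[y' ?]] := is_path_ends H; subst.

Lemma homot_cat A f f' g g' x y z : is_path A f x y -> is_path A g y z ->
  homot A f f' -> homot A g g' ->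
  homot A (concat_fun f g) (concat_fun f' g').
Proof.
move=> pf pg hf hg; have pf' := homot_paths pf hf; have pg' := homot_paths pg hg.
lift_ends pf x' y'; have [_ /lift_point[z' ?]] := is_path_ends pg; subst.
have [p /funext pE] := lift_path pf; have [q /funext qE] := lift_path pg.
have [p' /funext pE'] := lift_path pf'; have [q' /funext qE'] := lift_path pg'.
move: hf hg; rewrite -pE -qE -pE' -qE' -!val_concat !homot_val.
exact: concat_homotopic.
Qed.

Lemma homot_catA A f g h x y z w : is_path A f x y -> is_path A g y z ->
  is_path A h z w ->
  homot A (concat_fun (concat_fun f g) h) (concat_fun f (concat_fun g h)).
Proof.
move=> pf pg ph; lift_ends pf x' y'; lift_ends ph z' w'.
have [p /funext <-] := lift_path pf; have [q /funext <-] := lift_path pg.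
have [r /funext <-] := lift_path ph.
by rewrite -!val_concat homot_val; exact: concatA.
Qed.

Lemma homot_cat1p A f x y : is_path A f x y ->
  homot A (concat_fun (fun=> x) f) f.
Proof.
move=> pf; lift_ends pf x' y'; have [p /funext <-] := lift_path pf.
by have /homot_val := concat1p p; rewrite val_concat.
Qed.

Lemma homot_catp1 A f x y : is_path A f x y ->
  homot A (concat_fun f (fun=> y)) f.
Proof.
move=> pf; lift_ends pf x' y'; have [p /funext <-] := lift_path pf.
by have /homot_val := concatp1 p; rewrite val_concat.
Qed.

Lemma homot_catpV A f x y : is_path A f x y ->
  homot A (concat_fun f (reverse_fun f)) (fun=> x).
Proof.
move=> pf; lift_ends pf x' y'; have [p /funext <-] := lift_path pf.
by have /homot_val := concatpV p; rewrite val_concat.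
Qed.

Lemma homot_catVp A f x y : is_path A f x y ->
  homot A (concat_fun (reverse_fun f) f) (fun=> y).
Proof.
move=> pf; lift_ends pf x' y'; have [p /funext <-] := lift_path pf.
by have /homot_val := concatVp p; rewrite val_concat.
Qed.

Lemma homot_catl A f g h x y z : is_path A f x y -> is_path A h y z ->
  homot A f g -> homot A (concat_fun f h) (concat_fun g h).
Proof. by move=> pf ph fg; apply: (homot_cat pf ph fg); exact: homot_refl ph. Qed.

Lemma homot_catr A f g h x y z : is_path A h x y -> is_path A f y z ->
  homot A f g -> homot A (concat_fun h f) (concat_fun h g).
Proof. by move=> ph pf fg; apply: (homot_cat ph pf _ fg); exact: homot_refl ph. Qed.

Lemma homot_cancelr A f g h x y z : is_path A f x y -> is_path A g x y ->
  is_path A h y z -> homot A (concat_fun f h) (concat_fun g h) -> homot A f g.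
Proof.
move=> pf pg ph e; have pv := is_path_rev ph.
have key k (pk : is_path A k x y) :
    homot A (concat_fun (concat_fun k h) (reverse_fun h)) k.
  apply: homot_trans (homot_catA pk ph pv) _.
  apply: homot_trans (homot_catp1 pk).
  exact: homot_catr pk (is_path_cat ph pv) (homot_catpV ph).
apply: homot_trans (homot_sym (key _ pf)) _; apply: homot_trans (key _ pg).
exact: homot_catl (is_path_cat pf ph) pv e.
Qed.

Lemma homot_cancell A f g h x y z : is_path A f y z -> is_path A g y z ->
  is_path A h x y -> homot A (concat_fun h f) (concat_fun h g) -> homot A f g.
Proof.
move=> pf pg ph e; have pv := is_path_rev ph.
have key k (pk : is_path A k y z) :
    homot A (concat_fun (reverse_fun h) (concat_fun h k)) k.
  apply: homot_trans (homot_sym (homot_catA pv ph pk)) _.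
  apply: homot_trans (homot_cat1p pk).
  exact: homot_catl (is_path_cat pv ph) pk (homot_catVp ph).
apply: homot_trans (homot_sym (key _ pf)) _; apply: homot_trans (key _ pg).
exact: homot_catr pv (is_path_cat ph pf) e.
Qed.

(** * Subpaths, reparametrizations and squares *)

Definition subpath f (a b : R) (t : I) : T := f (clamp (a + (b - a) * ival t)).

Lemma is_path_subpath A f a b : continuous f -> (forall t, A (f t)) ->
  is_path A (subpath f a b) (f (clamp a)) (f (clamp b)).
Proof.
move=> cf Af; split.
- by apply: (@cts_comp _ _ _ (fun t : I => clamp (a + (b - a) * ival t)) f) => //; cts.
- by move=> t; exact: Af.
- by rewrite /subpath ival0 mulr0 addr0.
- by rewrite /subpath ival1 mulr1 addrC subrK.
Qed.

Lemma subpath_full f : subpath f 0 1 = f.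
Proof. by apply/funext => t; rewrite /subpath subr0 mul1r add0r clamp_ival. Qed.

(** Interpolate linearly between [u] and [v] in the parameter plane and apply [K]; only the
    membership of the image in [A] has to be checked. *)
Lemma homot_reparam A (K : R^o * R^o -> T) (u v : I -> R^o * R^o) :
  continuous K -> continuous u -> continuous v -> u zero = v zero ->
  u one = v one ->
  (forall s t, A (K ((1 - ival s) * (u t).1 + ival s * (v t).1,
                     (1 - ival s) * (u t).2 + ival s * (v t).2))) ->
  homot A (fun t => K (u t)) (fun t => K (v t)).
Proof.
move=> cK cu cv e0 e1 AK.
exists (fun w => K ((1 - ival w.1) * (u w.2).1 + ival w.1 * (v w.2).1,
                    (1 - ival w.1) * (u w.2).2 + ival w.1 * (v w.2).2)).
have c1 : continuous (fun w : I * I => (u w.2).1 : R^o).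
  exact: (cts_comp (cts_comp cts_snd cu) cts_fst).
have c2 : continuous (fun w : I * I => (u w.2).2 : R^o).
  exact: (cts_comp (cts_comp cts_snd cu) cts_snd).
have c3 : continuous (fun w : I * I => (v w.2).1 : R^o).
  exact: (cts_comp (cts_comp cts_snd cv) cts_fst).
have c4 : continuous (fun w : I * I => (v w.2).2 : R^o).
  exact: (cts_comp (cts_comp cts_snd cv) cts_snd).
split=> [|w|t|t|s]; rewrite /= ?ival0 ?ival1 ?subr0 ?subrr ?mul1r ?mul0r ?addr0
  ?add0r -?surjective_pairing//.
- by apply: (cts_comp _ cK); cts.
- by rewrite e0 e1 -!mulrDl !subrK !mul1r -!surjective_pairing.
Qed.

(** These are the two coordinates of a point running along two consecutive sides of the unit square,
    written by one continuous formula each. Concatenations thereby become reparametrizations, to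
    which [homot_reparam] applies. *)
Lemma broken_line (t : I) :
  if ival t <= 2^-1
  then Num.min 1 (2 * ival t) = ival (clamp (2 * ival t)) /\
       1 - Num.min 1 (2 - 2 * ival t) = 0
  else Num.min 1 (2 * ival t) = 1 /\
       1 - Num.min 1 (2 - 2 * ival t) = ival (clamp (2 * ival t - 1)).
Proof.
have /andP[t0 t1] := ival_itv t.
case: leP => ht; rewrite ival_clamp; try lra; rewrite !minEle; split.
- by case: leP => ?; lra.
- by case: leP => ?; lra.
- by case: leP => ?; lra.
- by case: leP => ?; lra.
Qed.

Lemma homot_subpath_cat A f a b c : continuous f -> (forall t, A (f t)) ->
  homot A (concat_fun (subpath f a b) (subpath f b c)) (subpath f a c).
Proof.
move=> cf Af.
pose u (t : I) : R^o * R^o := (a + (b - a) * Num.min 1 (2 * ival t) +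
   (c - b) * (1 - Num.min 1 (2 - 2 * ival t)), 0).
pose v (t : I) : R^o * R^o := (a + (c - a) * ival t, 0).
have -> : concat_fun (subpath f a b) (subpath f b c) =
    fun t => f (clamp (u t).1).
  apply/funext => t; rewrite /concat_fun /subpath /u /=.
  have := broken_line t; case: ifP => _ [-> ->]; congr (f (clamp _)); ring.
have -> : subpath f a c = fun t => f (clamp (v t).1) by [].
apply: (@homot_reparam A (fun w : R^o * R^o => f (clamp w.1)) u v) => //.
- by apply: (cts_comp _ cf); cts.
- by rewrite /u; cts.
- by rewrite /v; cts.
- rewrite /u /v ival0 /= !minEle; congr (_, _).
  by rewrite ifF ?ifT; try lra; apply/negP => h; lra.
- rewrite /u /v ival1 /= !minEle; congr (_, _).
  by rewrite ifT ?ifF; try lra; apply/negP => h; lra.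
Qed.

(** The two sides of the boundary join the same opposite corners of a convex square, so one is
    deformed into the other by interpolation. *)
Lemma homot_square A (K : I * I -> T) : continuous K -> (forall w, A (K w)) ->
  homot A (concat_fun (fun t => K (t, zero)) (fun t => K (one, t)))
          (concat_fun (fun t => K (zero, t)) (fun t => K (t, one))).
Proof.
move=> cK AK.
pose K' (w : R^o * R^o) := K (clamp w.1, clamp w.2).
pose m1 (t : I) : R^o := Num.min 1 (2 * ival t).
pose m2 (t : I) : R^o := 1 - Num.min 1 (2 - 2 * ival t).
have -> : concat_fun (fun t => K (t, zero)) (fun t => K (one, t)) =
    fun t => K' (m1 t, m2 t).
  apply/funext => t; rewrite /concat_fun /K' /m1 /m2 /=.
  by have := broken_line t; case: ifP => _ [-> ->]; rewrite clamp_ival.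
have -> : concat_fun (fun t => K (zero, t)) (fun t => K (t, one)) =
    fun t => K' (m2 t, m1 t).
  apply/funext => t; rewrite /concat_fun /K' /m1 /m2 /=.
  by have := broken_line t; case: ifP => _ [-> ->]; rewrite clamp_ival.
have m10 : m1 zero = 0 by rewrite /m1 ival0 minEle; case: leP => ?; lra.
have m11 : m1 one = 1 by rewrite /m1 ival1 minEle; case: leP => ?; lra.
have m20 : m2 zero = 0 by rewrite /m2 ival0 minEle; case: leP => ?; lra.
have m21 : m2 one = 1 by rewrite /m2 ival1 minEle; case: leP => ?; lra.
apply: (@homot_reparam A K' (fun t => (m1 t, m2 t)) (fun t => (m2 t, m1 t))).
- by apply: (cts_comp _ cK); cts.
- by rewrite /m1 /m2; cts.
- by rewrite /m1 /m2; cts.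
- by rewrite m10 m20.
- by rewrite m11 m21.
- by move=> s t; exact: AK.
Qed.

End Paths.

(** * Subdivision of the square *)

Section Subdivision.
Context {R : realType}.
Local Notation I := (unit_interval R).

(** Compactness of the square, stated for an arbitrary property of sets that passes to subsets. *)
Lemma lebesgue_number (P : set (R * R) -> Prop) :
  (forall M N, M `<=` N -> P N -> P M) ->
  (forall s t : I, exists2 N, nbhs ((ival s, ival t) : R * R) N & P N) ->
  exists2 e : R, 0 < e & forall s t : I,
    P [set w | `|ival s - w.1| <= e /\ `|ival t - w.2| <= e].
Proof.
move=> Psub Ploc.
have /compact_near_coveringP cK : compact (`[0, 1]%classic `*` `[0, 1]%classic : set (R * R)).
  by apply: compact_setX; exact: segment_compact.
have : \forall e \near (0 : R)^'+, `[0, 1]%classic `*` `[0, 1]%classic `<=`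
    (fun x : R * R => P [set w | `|x.1 - w.1| <= e /\ `|x.2 - w.2| <= e]).
  apply: cK => -[x y] [/= x01 y01].
  have [N Nxy PN] := Ploc (clamp x) (clamp y).
  move: Nxy; rewrite !ival_clamp // => -[[N1 N2]].
  move=> [/nbhs_ballP[e1 /= e10 N1e] /nbhs_ballP[e2 /= e20 N2e]] NN.
  (* Half of the smaller radius leaves room for moving the centre by [e] as well. *)
  pose e := Num.min e1 e2 / 2.
  have e0 : 0 < e by rewrite divr_gt0// lt_min e10.
  exists ([set w | ball x e w.1 /\ ball y e w.2], [set d | d < e]).
    split=> /=; last by apply: nbhs_right_lt.
    exists (ball x e, ball y e) => //=; split; exact: nbhsx_ballx.
  have tri (u u' v d e' : R) : ball u e u' -> d < e -> e <= e' / 2 ->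
      `|u' - v| <= d -> ball u e' v.
    rewrite /ball /= => ? ? ? ?; apply: le_lt_trans (ler_distD u' u v) _; lra.
  move=> [[x' y'] d] [/= [bx by'] de].
  apply: Psub PN => -[w1 w2] [/= h1 h2]; apply: NN; split => /=.
  - apply: N1e; apply: tri bx de _ h1; rewrite /e ler_pM2r ?invr_gt0//.
    by rewrite ge_min lexx.
  - apply: N2e; apply: tri by' de _ h2; rewrite /e ler_pM2r ?invr_gt0//.
    by rewrite ge_min lexx orbT.
move=> He; have [e [e0 {}He]] : exists e : R, 0 < e /\ `[0, 1]%classic `*` `[0, 1]%classic `<=`
    (fun x : R * R => P [set w | `|x.1 - w.1| <= e /\ `|x.2 - w.2| <= e]).
  have [e [? ?]] := filter_ex (filterI He (nbhs_right_gt (0 : R))).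
  by exists e.
exists e => // s t; apply: (He (ival s, ival t)).
by split; rewrite /= in_itv /= ival_itv.
Qed.

(** Since [clamp] does not increase distances, cells that stick out of the unit interval can be
    treated like the others. *)
Lemma clamp_dist (x y : R) : `|ival (clamp x) - ival (clamp y)| <= `|x - y|.
Proof.
have h1 := ler_norm (x - y); have := ler_norm (y - x); rewrite distrC => h2.
rewrite /ival /= !maxEle !minEle ler_norml.
 
by repeat (case: (leP _ 1) => ?); repeat (case: (leP 0 _) => ?);
  apply/andP; split; lra.
Qed.

(* The cell of index i is the interval [(i - 1) / n, i / n], so that the cells
   meeting at the vertex i / n are those of indices i and i + 1. *)
Definition cell (n i : nat) : set R := [set s | i%:R - 1 <= s * n%:R <= i%:R].

(** The indices are not bounded by [n]: cells outside the square are clamped to its boundary. In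
    particular the cell of index 0, which ends at 0, is collapsed to the point 0. *)
Lemma grid (T : topologicalType) (H : I * I -> T) (good : set (set T)) :
  continuous H -> (forall w, exists2 U, good U & nbhs (H w) U) ->
  exists2 n, (0 < n)%N & forall i j, exists2 U, good U &
    forall s t, cell n i s -> cell n j t -> U (H (clamp s, clamp t)).
Proof.
move=> cH goodH.
have [||e e0 He] := @lebesgue_number (fun N =>
    exists2 U, good U & forall w, N w -> U (H (clamp w.1, clamp w.2))).
- by move=> M N MN [U gU NU]; exists U => // w /MN; exact: NU.
- move=> s t; have [U gU HU] := goodH (s, t).
  exists ((fun w : R * R => H (clamp w.1, clamp w.2)) @^-1` U); last by exists U.
  have cHc : continuous (fun w : R^o * R^o => H (clamp w.1, clamp w.2)).
    by apply: (cts_comp _ cH); cts.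
  by apply: cHc; rewrite /= !clamp_ival.
(* As [n] exceeds the inverse of [e], every point of a cell is within [e] of the right end of that
   cell. *)
pose n := (Num.truncn e^-1).+1.
have n0 : 0 < n%:R :> R by rewrite ltr0n.
have ne : 1 <= e * n%:R.
  by rewrite mulrC -ler_pdivrMr// div1r ltW// truncnS_gt// invr_ge0 ltW.
exists n => // i j; have [U gU HU] := He (clamp (i%:R / n%:R)) (clamp (j%:R / n%:R)).
exists U => // s t si tj.
have near_cell k u : cell n k u ->
    `|ival (clamp (k%:R / n%:R)) - ival (clamp u)| <= e.
  move=> /andP[u1 u2]; apply: le_trans (clamp_dist _ _) _.
  rewrite -(ler_pM2r n0) -[X in _ * X](gtr0_norm n0) -normrM mulrBl divfK ?gt_eqF//.
  by rewrite ger0_norm; lra.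
rewrite -[clamp s]clamp_ival -[clamp t]clamp_ival.
by apply: (HU (ival (clamp s), ival (clamp t))); split; exact: near_cell.
Qed.

(** Cousin's lemma: cut the unit interval into pieces shorter than a Lebesgue number and add them up
    from the left. It replaces explicit subdivisions wherever a property of subpaths is additive. *)
Lemma cousin (P : R -> R -> Prop) :
  (forall a b c, a <= b -> b <= c -> P a b -> P b c -> P a c) ->
  (forall t : I, exists2 N, nbhs (ival t) N &
     forall a b, 0 <= a -> a <= b -> b <= 1 -> N a -> N b -> P a b) ->
  P 0 1.
Proof.
move=> Padd Ploc.
(* The second coordinate of the square is a dummy; it is set to 0 below. *)
have [||e e0 He] := @lebesgue_number (fun N => forall a b y, 0 <= a -> a <= b ->
    b <= 1 -> N (a, y) -> N (b, y) -> P a b).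
- by move=> M N MN PN a b y a0 ab b1 /MN aN /MN; exact: PN.
- move=> s t; have [N sN NP] := Ploc s.
  exists (fst @^-1` N); last by move=> a b y a0 ab b1; exact: NP.
  by exists (N, setT) => //=; [split=> //; exact: filterT|move=> ? []].
pose n := (Num.truncn e^-1).+1.
have n0 : 0 < n%:R :> R by rewrite ltr0n.
have ne : n%:R^-1 <= e.
  by rewrite invf_ple ?posrE// ltW// truncnS_gt// invr_ge0 ltW.
have step m : (m < n)%N -> P (m%:R / n%:R) (m.+1%:R / n%:R).
  move=> mn; have m0 : 0 <= m%:R / n%:R :> R by rewrite divr_ge0.
  have m1 : m.+1%:R / n%:R <= 1 :> R by rewrite ler_pdivrMr// mul1r ler_nat.
  have mS : m.+1%:R / n%:R = m%:R / n%:R + n%:R^-1 :> R.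
    by rewrite -addn1 natrD mulrDl mul1r.
  have n10 : 0 < n%:R^-1 :> R by rewrite invr_gt0.
  have mc : ival (clamp (m%:R / n%:R)) = m%:R / n%:R :> R.
    by rewrite ival_clamp// m0 /=; lra.
  apply: (He (clamp (m%:R / n%:R)) zero _ _ 0) => //; rewrite /= ?mc ?ival0.
  - by lra.
  - rewrite !subrr normr0. split; lra.
  - by rewrite mS opprD addrA subrr sub0r normrN gtr0_norm// subrr normr0; split; lra.
have {step} steps m : (0 < m <= n)%N -> P 0 (m%:R / n%:R).
  elim: m => // -[_ _|m IH /andP[_ mn]]; first by have := step 0%N isT; rewrite mul0r; apply.
  apply: (Padd _ (m.+1%:R / n%:R)); first by rewrite divr_ge0.
  - by rewrite ler_pM2r ?invr_gt0// ler_nat.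
  - by apply: IH; rewrite (ltnW mn).
  - exact: step.
by have := steps n; rewrite divff ?gt_eqF// leqnn; apply.
Qed.

End Subdivision.

(** * Pushing paths and homotopies into a dense subset *)

Section Chains.
Context {R : realType} {T : topologicalType}.
Local Notation I := (unit_interval R).
Implicit Types (A : set T) (f : I -> T) (a b v : nat -> I -> T) (x y : nat -> T).

(** The leading constant path gives a meaning to the empty chain, from which the inductions
    start. *)
Fixpoint chain (x0 : T) a m : I -> T :=
  if m is m'.+1 then concat_fun (chain x0 a m') (a m') else fun=> x0.

Lemma is_path_chain A a x m : A (x 0%N) ->
  (forall j, is_path A (a j) (x j) (x j.+1)) ->
  is_path A (chain (x 0%N) a m) (x 0%N) (x m).
Proof.
move=> Ax pa; elim: m => [|m IH] /=; first exact: is_path_cst.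
exact: is_path_cat IH (pa m).
Qed.

Lemma chain_homot A a b x m : A (x 0%N) ->
  (forall j, is_path A (a j) (x j) (x j.+1)) ->
  (forall j, homot A (a j) (b j)) ->
  homot A (chain (x 0%N) a m) (chain (x 0%N) b m).
Proof.
move=> Ax pa ab; elim: m => [|m IH] /=.
  exact: homot_refl (is_path_cst Ax).
exact: homot_cat (is_path_chain m Ax pa) (pa m) IH (ab m).
Qed.

(** Each commuting square moves the vertical path one rung to the left; after [m] of them [v m] has
    become [v 0]. *)
Lemma ladder A a b v x y m :
  (forall j, is_path A (a j) (x j) (x j.+1)) ->
  (forall j, is_path A (b j) (y j) (y j.+1)) ->
  (forall j, is_path A (v j) (x j) (y j)) ->
  (forall j, homot A (concat_fun (a j) (v j.+1)) (concat_fun (v j) (b j))) ->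
  homot A (concat_fun (chain (x 0%N) a m) (v m))
          (concat_fun (v 0%N) (chain (y 0%N) b m)).
Proof.
move=> pa pb pv sq; have [Ax Ay] := is_path_ends (pv 0%N).
elim: m => [|m IH] /=.
  apply: homot_trans (homot_cat1p (pv 0%N)) _.
  exact: homot_sym (homot_catp1 (pv 0%N)).
have pam := is_path_chain m Ax pa; have pbm := is_path_chain m Ay pb.
apply: homot_trans (homot_catA pam (pa m) (pv m.+1)) _.
apply: homot_trans (homot_catr pam (is_path_cat (pa m) (pv m.+1)) (sq m)) _.
apply: homot_trans (homot_sym (homot_catA pam (pv m) (pb m))) _.
apply: homot_trans (homot_catl (is_path_cat pam (pv m)) (pb m) IH) _.
exact: homot_catA (pv 0%N) pbm (pb m).
Qed.

Lemma ladder_cst A a b v x y m :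
  (forall j, is_path A (a j) (x j) (x j.+1)) ->
  (forall j, is_path A (b j) (y j) (y j.+1)) ->
  (forall j, is_path A (v j) (x j) (y j)) ->
  (forall j, homot A (concat_fun (a j) (v j.+1)) (concat_fun (v j) (b j))) ->
  homot A (v 0%N) (fun=> x 0%N) -> homot A (v m) (fun=> x m) ->
  homot A (chain (x 0%N) a m) (chain (y 0%N) b m).
Proof.
move=> pa pb pv sq v0 vm; have [Ax Ay] := is_path_ends (pv 0%N).
have pam := is_path_chain m Ax pa; have pbm := is_path_chain m Ay pb.
apply: homot_trans (homot_sym (homot_catp1 pam)) _.
(* A path homotopic to a constant has equal ends, so the two rows start at a common point and end at
   a common point. *)
have [_ xym] := homot_ends vm; have [_ xy0] := homot_ends v0.
have [_ _ _ v01] := pv 0%N; have [_ _ _ vm1] := pv m.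
have pxy : is_path A (fun=> x m) (x m) (y m).
  by split=> //; rewrite -?vm1 ?xym//; [exact: cts_cst|case: (is_path_ends (pv m))].
apply: homot_trans (homot_sym (homot_catr pam (pv m) vm)) _.
apply: homot_trans (ladder m pa pb pv sq) _.
apply: homot_trans (homot_catl (pv 0%N) pbm v0) _.
have -> : x 0%N = y 0%N by rewrite -v01 xy0.
exact: homot_cat1p pbm.
Qed.

Lemma chain_subpath A f n m : continuous f -> (forall t, A (f t)) ->
  homot A (chain (f zero) (fun j => subpath f (j%:R / n%:R) (j.+1%:R / n%:R)) m)
          (subpath f 0 (m%:R / n%:R)).
Proof.
move=> cf Af; elim: m => [|m IH] /=.
  have -> : subpath f 0 (0%:R / n%:R) = fun=> f zero.
    by apply/funext => t; rewrite /subpath mul0r subrr mul0r addr0.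
  exact: homot_refl (is_path_cst (Af zero)).
apply: homot_trans (homot_subpath_cat 0 (m%:R / n%:R) _ cf Af).
have p1 (r s : R) := is_path_subpath r s cf Af.
have pc : is_path A (chain (f zero) (fun j =>
    subpath f (j%:R / n%:R) (j.+1%:R / n%:R)) m) (f zero) (f (clamp (m%:R / n%:R))).
  exact: homot_paths (p1 _ _) (homot_sym IH).
exact: homot_catl pc (p1 _ _) IH.
Qed.

End Chains.

(** * The local criterion: dense cells and good cells *)

Section LocalCriterion.
Context {R : realType} {T : topologicalType}.
Local Notation I := (unit_interval R).
Implicit Types (A B X Y U O : set T) (f g : I -> T) (x y : T).

Definition path_connected A :=
  forall x y, A x -> A y -> exists f : I -> T, is_path A f x y.

(** The homotopy may leave [A]: only the class of the paths in the larger set [B] matters. *)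
Definition unique_paths A B := forall (f g : I -> T) x y,
  is_path A f x y -> is_path A g x y -> homot B f g.

Definition dense_cell Y U :=
  [/\ open U, U `&` Y !=set0 & path_connected (U `&` Y)].

Definition local_basis X (good : set (set T)) := forall x O, X x -> nbhs x O ->
  exists U, [/\ good U, U x & U `<=` O].

(** Follow the path through a succession of cells: consecutive cells share a point of [Y], and
    inside each cell two points of [Y] can be joined within [Y]. Keeping all cells inside [O]
    controls where the new path runs. *)
Lemma path_push X Y O f x y : local_basis X (dense_cell Y) -> open O ->
  is_path (X `&` O) f x y ->
  forall W W' y1 y2, dense_cell Y W -> dense_cell Y W' ->
  W `<=` O -> W' `<=` O -> W x -> W' y -> (W `&` Y) y1 -> (W' `&` Y) y2 ->
  exists g : I -> T, is_path (O `&` Y) g y1 y2.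
Proof.
move=> basis oO [cf Af <- <-].
(* Quantifying over the cells at both ends and over the points chosen in them makes this property
   additive: two pieces are glued at a point of any cell around the cut. *)
pose P a b := forall W W' y1 y2, dense_cell Y W -> dense_cell Y W' ->
  W `<=` O -> W' `<=` O -> W (f (clamp a)) -> W' (f (clamp b)) ->
  (W `&` Y) y1 -> (W' `&` Y) y2 -> exists g : I -> T, is_path (O `&` Y) g y1 y2.
suff P01 : P 0 1 by exact: P01.
apply: (@cousin R P) => [a b c ab bc Pab Pbc W W' y1 y2 gW gW' WO W'O Wa W'c Wy1 Wy2|t].
  have [Xb Ob] := Af (clamp b).
  have [V [gV Vb VO]] := basis _ O Xb (open_nbhs_nbhs (conj oO Ob)).
  have [_ [z Vz] _] := gV.
  have [g1 pg1] := Pab _ _ _ _ gW gV WO VO Wa Vb Wy1 Vz.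
  have [g2 pg2] := Pbc _ _ _ _ gV gW' VO W'O Vb W'c Vz Wy2.
  by exists (concat_fun g1 g2); exact: is_path_cat pg1 pg2.
have [Xt Ot] := Af t.
have [V [[oV V0 Vpc] Vt VO]] := basis _ O Xt (open_nbhs_nbhs (conj oO Ot)).
have cfc : continuous (fun a : R^o => f (clamp a)) by exact: (cts_comp (@clamp_continuous R) cf).
exists ((fun a => f (clamp a)) @^-1` V).
  by apply: cfc; rewrite clamp_ival; exact: open_nbhs_nbhs.
move=> a b _ _ _ Va Vb W W' y1 y2 gW gW' WO W'O Wa W'c Wy1 Wy2.
(* Two cells sharing a point of [X] contain a third cell around it, hence share a point of [Y]. *)
have meet U a' : dense_cell Y U -> U (f (clamp a')) -> V (f (clamp a')) ->
    exists z, (U `&` Y) z /\ (V `&` Y) z.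
  move=> [oU _ _] Ua Va'; have [Xa _] := Af (clamp a').
  have nUV : nbhs (f (clamp a')) (U `&` V).
    by apply: open_nbhs_nbhs; split => //; exact: openI.
  have [V' [[_ [z [V'z Yz]] _] _ V'UV]] := basis _ _ Xa nUV.
  by have [Uz Vz] := V'UV _ V'z; exists z.
have [z1 [Wz1 Vz1]] := meet W a gW Wa Va.
have [z2 [Wz2 Vz2]] := meet W' b gW' W'c Vb.
have inO U : U `<=` O -> U `&` Y `<=` O `&` Y.
  by move=> UO z [Uz Yz]; split=> //; exact: UO.
have [_ _ Wpc] := gW; have [_ _ W'pc] := gW'.
have [g1 /(is_pathS (inO _ WO)) p1] := Wpc _ _ Wy1 Wz1.
have [g2 /(is_pathS (inO _ VO)) p2] := Vpc _ _ Vz1 Vz2.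
have [g3 /(is_pathS (inO _ W'O)) p3] := W'pc _ _ Wz2 Wy2.
exists (concat_fun g1 (concat_fun g2 g3)).
exact: is_path_cat p1 (is_path_cat p2 p3).
Qed.

(** For a point of [Y], the point chosen in its cell is the point itself, so the pushed path has the
    prescribed ends. With [X] the whole product of symmetric powers, this shows that the braiding
    divisors are path connected. *)
Lemma path_connected_dense X Y : local_basis X (dense_cell Y) -> Y `<=` X ->
  path_connected X -> path_connected Y.
Proof.
move=> basis YX Xpc x y Yx Yy; have [f pf] := Xpc _ _ (YX _ Yx) (YX _ Yy).
have [W [gW Wx _]] := basis x setT (YX _ Yx) (@filterT _ _ _).
have [W' [gW' Wy _]] := basis y setT (YX _ Yy) (@filterT _ _ _).
have pf' : is_path (X `&` setT) f x y by rewrite setIT.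
have [g] := path_push basis openT pf' gW gW' (@subsetT _ _) (@subsetT _ _)
  Wx Wy (conj Wx Yx) (conj Wy Yy).
by rewrite setTI; exists g.
Qed.

Variables X Y : set T.

Definition good_cell U := [/\ dense_cell Y U, path_connected (U `&` X),
  unique_paths (U `&` X) X & unique_paths (U `&` Y) Y].

Hypothesis basis : local_basis X good_cell.
Hypothesis YX : Y `<=` X.

Let dense_basis : local_basis X (dense_cell Y).
Proof.
move=> x O Xx xO; have [U [[dU _ _ _] Ux UO]] := basis Xx xO.
by exists U.
Qed.

(** A vertex outside [Y] is moved to a nearby point of [Y]; a vertex already in [Y] stays in place,
    which keeps the ends of paths and the boundary of homotopies fixed. *)
Lemma vertex x O : X x -> nbhs x O -> exists Wy : set T * T,
  [/\ good_cell Wy.1, Wy.1 x, Wy.1 `<=` O, (Wy.1 `&` Y) Wy.2 & Y x -> Wy.2 = x].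
Proof.
move=> Xx xO; have [W [gW Wx WO]] := basis Xx xO.
have [Yx|Yx] := pselect (Y x); first by exists (W, x).
by have [[_ [y Wy] _] _ _ _] := gW; exists (W, y); split.
Qed.

(** Cut the square so finely that each cell is mapped into a good cell. Move the vertices into [Y],
    then the edges inside the cells that they bound. The boundary of each small square now commutes
    in [Y] by uniqueness of paths, and successive rows are compared by [ladder_cst]. The homotopy
    itself is never moved. *)
Lemma homotopy_push f g x y : is_path Y f x y -> is_path Y g x y ->
  homot X f g -> homot Y f g.
Proof.
move=> pf pg [H [cH XH H0 H1 H2]].
have [|n n0 HU] := @grid R T H (fun U => good_cell U /\ open U) cH.
  move=> w; have [U [gU Uw _]] := basis (XH w) (@filterT _ _ _).
  have [[oU _ _] _ _ _] := gU.
  by exists U => //; exact: open_nbhs_nbhs.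
have /choice[U {}HU] : forall ij : nat * nat, exists U, [/\ good_cell U, open U &
    forall s t, cell n ij.1 s -> cell n ij.2 t -> U (H (clamp s, clamp t))].
  by move=> [i j]; have [U [gU oU] UH] := HU i j; exists U.
pose vx (ij : nat * nat) := H (clamp (ij.1%:R / n%:R), clamp (ij.2%:R / n%:R)).
have nR : n%:R != 0 :> R by rewrite pnatr_eq0 -lt0n.
have cell_edge (i : nat) (t : I) : cell n i.+1 ((i%:R + ival t) / n%:R :> R).
  rewrite /cell /= divfK// -addn1 natrD.
  by have := ival_itv t; lra.
have cell0 i : cell n i (i%:R / n%:R :> R).
  by rewrite /cell /= divfK//; lra.
have cell1 i : cell n i.+1 (i%:R / n%:R :> R).
  by rewrite /cell /= divfK// -addn1 natrD; lra.
(* The intersection of the four cells that meet at a vertex. *)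
pose O ij := U (ij.1, ij.2) `&` U (ij.1.+1, ij.2) `&`
  (U (ij.1, ij.2.+1) `&` U (ij.1.+1, ij.2.+1)).
have /choice[Wy HWy] : forall ij, exists Wy : set T * T,
    [/\ good_cell Wy.1, Wy.1 (vx ij), Wy.1 `<=` O ij, (Wy.1 `&` Y) Wy.2 &
      Y (vx ij) -> Wy.2 = vx ij].
  move=> [i j]; apply: vertex; first exact: XH.
  have nU i' j' : cell n i' (i%:R / n%:R : R) -> cell n j' (j%:R / n%:R : R) ->
      nbhs (vx (i, j)) (U (i', j')).
    move=> ci cj; have [_ oU HUw] := HU (i', j').
    by apply: open_nbhs_nbhs; split=> //; exact: HUw.
  by apply: filterI; apply: filterI; apply: nU.
pose y_ i j := (Wy (i, j)).2.
have Yy i j : Y (y_ i j) by have [_ _ _ []] := HWy (i, j).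
have push i j i' j' (A B : set T) (k : I -> T) : open A -> open B ->
    is_path (X `&` (A `&` B)) k (vx (i, j)) (vx (i', j')) ->
    O (i, j) `<=` A `&` B -> O (i', j') `<=` A `&` B ->
    exists e : I -> T, is_path (A `&` B `&` Y) e (y_ i j) (y_ i' j').
  move=> oA oB pk OA OA'; have [[dW _ _ _] Wx WO Wy1 _] := HWy (i, j).
  have [[dW' _ _ _] Wx' WO' Wy1' _] := HWy (i', j').
  apply: (path_push dense_basis (openI oA oB) pk dW dW' _ _ Wx Wx' Wy1 Wy1').
    exact: subset_trans WO OA.
  exact: subset_trans WO' OA'.
have edge_cts (u v : I -> R^o) : continuous u -> continuous v ->
    continuous (fun t : I => H (clamp (u t / n%:R), clamp (v t / n%:R))).
  by move=> cu cv; apply: (cts_comp _ cH); cts.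
(* The edges [e] follow the path parameter and form the rows; the edges [v] below follow the
   homotopy parameter. Each is pushed inside the two cells that it separates. *)
have /choice[e He] : forall ij, exists e : I -> T,
    is_path (U (ij.1.+1, ij.2.+1) `&` U (ij.1, ij.2.+1) `&` Y) e
      (y_ ij.1 ij.2) (y_ ij.1 ij.2.+1).
  move=> [i j] /=; apply: (push _ _ _ _ _ _
    (fun t => H (clamp (i%:R / n%:R), clamp ((j%:R + ival t) / n%:R)))).
  - by have [] := HU (i.+1, j.+1).
  - by have [] := HU (i, j.+1).
  - split.
    + by apply: (edge_cts (fun=> i%:R) (fun t => j%:R + ival t)); cts.
    + move=> t; split; first exact: XH.
      split; [have [_ _] := HU (i.+1, j.+1)|have [_ _] := HU (i, j.+1)];
        by apply => /=.
    + by rewrite ival0 addr0.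
    + by rewrite ival1 natr1.
  - by move=> z [_ []].
  - by move=> z [[? ?] [? ?]].
have /choice[v Hv] : forall ij, exists v : I -> T,
    is_path (U (ij.1.+1, ij.2.+1) `&` U (ij.1.+1, ij.2) `&` Y) v
      (y_ ij.1 ij.2) (y_ ij.1.+1 ij.2).
  move=> [i j] /=; apply: (push _ _ _ _ _ _
    (fun t => H (clamp ((i%:R + ival t) / n%:R), clamp (j%:R / n%:R)))).
  - by have [] := HU (i.+1, j.+1).
  - by have [] := HU (i.+1, j).
  - split.
    + by apply: (edge_cts (fun t => i%:R + ival t) (fun=> j%:R)); cts.
    + move=> t; split; first exact: XH.
      split; [have [_ _] := HU (i.+1, j.+1)|have [_ _] := HU (i.+1, j)];
        by apply => /=.
    + by rewrite ival0 addr0.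
    + by rewrite ival1 natr1.
  - by move=> z [[? ?] [? ?]].
  - by move=> z [[? ?] [? ?]].
have unq i j (k1 k2 : I -> T) x1 x2 : is_path (U (i, j) `&` Y) k1 x1 x2 ->
    is_path (U (i, j) `&` Y) k2 x1 x2 -> homot Y k1 k2.
  move=> p1 p2; have [[_ _ _ uU] _ _] := HU (i, j).
  exact: (uU _ _ _ _ p1 p2).
have eY i j : is_path Y (e (i, j)) (y_ i j) (y_ i j.+1).
  by apply: is_pathS (He (i, j)) => ? [].
have vY i j : is_path Y (v (i, j)) (y_ i j) (y_ i.+1 j).
  by apply: is_pathS (Hv (i, j)) => ? [].
(* All four edges of the square between rows [i] and [i.+1] lie in the cell of index
   [(i.+1, j.+1)]. *)
have sq i j : homot Y (concat_fun (e (i, j)) (v (i, j.+1)))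
                      (concat_fun (v (i, j)) (e (i.+1, j))).
  apply: (unq i.+1 j.+1).
    apply: (is_path_cat (y := y_ i j.+1)).
      by apply: is_pathS (He (i, j)) => ? [[]].
    by apply: is_pathS (Hv (i, j.+1)) => ? [[]].
  apply: (is_path_cat (y := y_ i.+1 j)).
    by apply: is_pathS (Hv (i, j)) => ? [[]].
  by apply: is_pathS (He (i.+1, j)) => ? [[]].
(* A row already in [Y] keeps its vertices, and each of its pieces has the same ends as the pushed
   edge in a common cell, hence is homotopic to it in [Y]. *)
have row_push (k : I -> T) i : is_path Y k x y ->
    (forall t, H (clamp (i%:R / n%:R), t) = k t) ->
    homot Y k (chain x (fun j => e (i, j)) n).
  move=> [ck Yk k0 k1] Hk.
  have vxE j : vx (i, j) = k (clamp (j%:R / n%:R)) by rewrite /vx /= Hk.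
  have yE j : y_ i j = k (clamp (j%:R / n%:R)).
    by have [_ _ _ _] := HWy (i, j); rewrite vxE; apply.
  have sub j : is_path (U (i.+1, j.+1) `&` Y)
      (subpath k (j%:R / n%:R) (j.+1%:R / n%:R)) (y_ i j) (y_ i j.+1).
    have [cs _ s0 s1] := @is_path_subpath R T setT k
      (j%:R / n%:R) (j.+1%:R / n%:R) ck (fun=> Logic.I).
    rewrite !yE; split=> // t; split; last exact: Yk.
    rewrite /subpath -Hk; have [_ _] := HU (i.+1, j.+1); apply => //=.
    rewrite -mulrBl -natr1 addrAC subrr add0r mulrAC -mulrDl mul1r.
    exact: cell_edge.
  have <- : y_ i 0%N = x by rewrite yE mul0r k0.
  have subY j := is_pathS (@subIsetr _ _ _) (sub j).
  have eU j : is_path (U (i.+1, j.+1) `&` Y) (e (i, j)) (y_ i j) (y_ i j.+1).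
    by apply: is_pathS (He (i, j)) => ? [[]].
  have := chain_homot n (Yy i 0%N) subY (fun j => unq _ _ _ _ _ _ (sub j) (eU j)).
  apply: homot_trans; apply: homot_sym.
  have := chain_subpath n n ck Yk; rewrite divff// subpath_full.
  by rewrite yE mul0r.
(* On the two sides where [H] is constant, the pushed vertical edge is a loop inside one cell, hence
   contractible in [Y]. *)
have col_cst i j (z : T) : Y z -> (forall s, H (s, clamp (j%:R / n%:R)) = z) ->
    homot Y (v (i, j)) (fun=> y_ i j).
  move=> Yz Hz; have yE i' : y_ i' j = z.
    by have [_ _ _ _] := HWy (i', j); rewrite /vx Hz; apply.
  have [_ Uv v0 v1] := Hv (i, j).
  apply: (unq i.+1 j.+1 _ _ (y_ i j) (y_ i j)).
    have := Hv (i, j); rewrite [y_ i.+1 j]yE -(yE i).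
    by apply: is_pathS => ? [[]].
  apply: is_path_cst; split=> //; rewrite -v0.
  by have [[]] := Uv zero.
have [cf Yf f0 f1] := pf; have [_ _ g0 g1] := pg.
have clampn : clamp (n%:R / n%:R) = one :> I by rewrite divff.
have clamp0 : clamp (0%:R / n%:R) = zero :> I by rewrite mul0r.
have Hleft s : H (s, clamp (0%:R / n%:R)) = x.
  by rewrite clamp0 -f0; have [] := H2 s.
have Hright s : H (s, clamp (n%:R / n%:R)) = y.
  by rewrite clampn -f1; have [] := H2 s.
have [Yx Yy'] := is_path_ends pf.
have y0 i : y_ i 0%N = x.
  by have [_ _ _ _] := HWy (i, 0%N); rewrite /vx Hleft; apply.
have rows i : homot Y (chain x (fun j => e (0%N, j)) n) (chain x (fun j => e (i, j)) n).
  elim: i => [|i IH].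
    by apply: homot_refl; rewrite -(y0 0%N); exact: is_path_chain (Yy _ _) (eY 0%N).
  apply: homot_trans IH _; rewrite -{1}(y0 i) -(y0 i.+1).
  apply: (ladder_cst (v := fun j => v (i, j)) (eY i) (eY i.+1) (vY i) (sq i)).
    exact: col_cst Yx Hleft.
  exact: col_cst Yy' Hright.
apply: homot_trans (row_push f 0%N pf _) _; first by move=> t; rewrite clamp0.
apply: homot_trans (rows n) _; apply: homot_sym; apply: row_push pg _ => t.
by rewrite clampn.
Qed.

(** The one-parameter version: replace each piece of [f] by a path of [Y] in the same cell. Short
    paths in [X] from the old vertices to the new ones are the rungs of a ladder whose squares
    commute by uniqueness of paths. *)
Lemma path_homot_push f x y : is_path X f x y -> Y x -> Y y ->
  exists2 g : I -> T, is_path Y g x y & homot X f g.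
Proof.
move=> [cf Xf f0 f1] Yx Yy.
(* The first parameter is a dummy; it is evaluated at 0, which lies in the cell of index 0. *)
have [|n n0 HU] := @grid R T (fun w => f w.2) (fun U => good_cell U /\ open U)
  (cts_comp cts_snd cf).
  move=> w; have [U [gU Uw _]] := basis (Xf w.2) (@filterT _ _ _).
  have [[oU _ _] _ _ _] := gU.
  by exists U => //; exact: open_nbhs_nbhs.
have /choice[U {}HU] : forall j, exists U, [/\ good_cell U, open U &
    forall t, cell n j t -> U (f (clamp t))].
  move=> j; have [U [gU oU] UH] := HU 0%N j; exists U; split=> // t.
  by apply: (UH 0) => //; rewrite /cell /= mul0r; lra.
pose vx j := f (clamp (j%:R / n%:R)).
have nR : n%:R != 0 :> R by rewrite pnatr_eq0 -lt0n.
have cell_edge (i : nat) (t : I) : cell n i.+1 ((i%:R + ival t) / n%:R :> R).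
  rewrite /cell /= divfK// -addn1 natrD.
  by have := ival_itv t; lra.
have cell0 i : cell n i (i%:R / n%:R :> R).
  by rewrite /cell /= divfK//; lra.
have cell1 i : cell n i.+1 (i%:R / n%:R :> R).
  by rewrite /cell /= divfK// -addn1 natrD; lra.
have /choice[Wy HWy] : forall j, exists Wy : set T * T,
    [/\ good_cell Wy.1, Wy.1 (vx j), Wy.1 `<=` U j `&` U j.+1, (Wy.1 `&` Y) Wy.2 &
      Y (vx j) -> Wy.2 = vx j].
  move=> j; apply: vertex; first exact: Xf.
  have nU j' : cell n j' (j%:R / n%:R : R) -> nbhs (vx j) (U j').
    move=> cj; have [_ oU HUw] := HU j'.
    by apply: open_nbhs_nbhs; split=> //; exact: HUw.
  by apply: filterI; exact: nU.
pose y_ j := (Wy j).2.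
have /choice[e He] j : exists e : I -> T, is_path (U j.+1 `&` Y) e (y_ j) (y_ j.+1).
  have [[[_ _ pc] _ _ _] _ _] := HU j.+1; apply: pc.
    by have [_ _ WU [Wy1 Yy1] _] := HWy j; split=> //; have [] := WU _ Wy1.
  by have [_ _ WU [Wy1 Yy1] _] := HWy j.+1; split=> //; have [] := WU _ Wy1.
(* A rung at an unmoved vertex is a loop in a cell, hence contractible; this applies at the two ends
   of [f]. *)
have /choice[v Hv] j : exists v : I -> T,
    is_path (U j `&` U j.+1 `&` X) v (vx j) (y_ j) /\
    (y_ j = vx j -> homot X v (fun=> vx j)).
  have [[_ pcX uX _] Wx WU [Wy1 Yy1] _] := HWy j.
  have [v pv] := pcX _ _ (conj Wx (Xf _)) (conj Wy1 (YX Yy1)).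
  exists v; split; first by apply: is_pathS pv; exact: setSI.
  move=> yE; apply: uX pv _; rewrite /y_ in yE; rewrite yE.
  by apply: is_path_cst; split=> //; exact: Xf.
have subX j : is_path X (subpath f (j%:R / n%:R) (j.+1%:R / n%:R)) (vx j) (vx j.+1).
  exact: is_path_subpath cf Xf.
have eY j : is_path Y (e j) (y_ j) (y_ j.+1).
  by apply: is_pathS (He j) => ? [].
have eX j := is_pathS YX (eY j).
have vX j : is_path X (v j) (vx j) (y_ j).
  by have [pv _] := Hv j; apply: is_pathS pv => ? [].
have sq j : homot X (concat_fun (subpath f (j%:R / n%:R) (j.+1%:R / n%:R)) (v j.+1))
    (concat_fun (v j) (e j)).
  have [[_ _ uX _] _ HUw] := HU j.+1; apply: (uX _ _ (vx j) (y_ j.+1)).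
    apply: (@is_path_cat _ _ _ _ _ _ (vx j.+1)); last first.
      by have [pv _] := Hv j.+1; apply: is_pathS pv => ? [[]].
    have [cs Xs s0 s1] := subX j; split=> // t; split; last exact: Xs.
    rewrite /subpath; apply: HUw.
    rewrite -mulrBl -natr1 addrAC subrr add0r mulrAC -mulrDl mul1r.
    exact: cell_edge.
  apply: (@is_path_cat _ _ _ _ _ _ (y_ j)).
    by have [pv _] := Hv j; apply: is_pathS pv => ? [[]].
  by apply: is_pathS (He j) => ? [? /YX].
have clampn : clamp (n%:R / n%:R) = one :> I by rewrite divff.
have clamp0 : clamp (0%:R / n%:R) = zero :> I by rewrite mul0r.
have vx0 : vx 0%N = x by rewrite /vx clamp0.
have vxn : vx n = y by rewrite /vx clampn.
have yv j : Y (vx j) -> y_ j = vx j by have [_ _ _ _] := HWy j.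
have v_cst j : Y (vx j) -> homot X (v j) (fun=> vx j).
  by move=> /yv yj; have [_] := Hv j; apply.
exists (chain x e n).
  have := @is_path_chain R T Y e y_ n; rewrite yv ?vx0// yv ?vxn//; apply=> //.
have := ladder_cst (m := n) subX eX vX sq; rewrite vx0 yv ?vx0 ?vxn//.
move=> lad; apply: homot_trans (lad _ _); last 2 first.
- by have := v_cst 0%N; rewrite vx0; apply.
- by have := v_cst n; rewrite vxn; apply.
apply: homot_sym; have := chain_subpath n n cf Xf.
by rewrite divff// subpath_full f0.
Qed.

End LocalCriterion.
Arguments path_connected R {T} A.
Arguments unique_paths R {T} A B.
Arguments dense_cell R {T} Y U.
Arguments good_cell R {T} X Y U.

(** * Isomorphism of fundamental groups *)

(** A relation spares the choice of a loop of [Y] for each class of [X] until all its properties are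
    known. *)
Lemma group_isomorphic_rel (G H : groupType) (r : G -> H -> Prop) :
  (forall a, exists b, r a b) -> (forall b, exists a, r a b) ->
  (forall a b b', r a b -> r a b' -> b = b') ->
  (forall a a' b, r a b -> r a' b -> a = a') ->
  (forall a a' b b', r a b -> r a' b' -> r (a * a')%g (b * b')%g) ->
  group_isomorphic G H.
Proof.
move=> /choice[f fr] /choice[g gr] r_fun r_inj rM.
have fM : {morph f : x y / (x * y)%g >-> (x * y)%g}.
  by move=> x y; apply: (r_fun _ _ _ (fr _)); exact: rM.
pose F := isMultiplicative.Build G H f fM.
exists (HB.pack_for {multiplicative G -> H} f F); exists g => [x|y] /=.
  by apply: (r_inj _ _ _ (gr _)); exact: fr.
by apply: (r_fun _ _ _ (fr _)); exact: gr.
Qed.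

Section Pi1Isomorphism.
Context {R : realType} {T : topologicalType} (X Y : set T).
Local Notation I := (unit_interval R).

Hypothesis basis : local_basis X (good_cell R X Y).
Hypothesis YX : Y `<=` X.
Hypothesis Xpc : path_connected R X.

(** Every class of loops of [X] has a related class of [Y] by [path_homot_push], and at most one by
    [homotopy_push]. The remaining properties of the relation follow from the groupoid laws in
    [X]. *)
Lemma pi1_isomorphic (d : set_type X) (e : set_type Y) :
  group_isomorphic (pi1 R d) (pi1 R e).
Proof.
have Xe : X (\val e) := YX (set_valP e).
have [c pc] := Xpc Xe (set_valP d).
pose lp (Z : set T) (x : set_type Z) (a : pi1 R x) (t : I) : T := \val (repr a t).
have lpP (Z : set T) (x : set_type Z) (a : pi1 R x) :
  is_path Z (lp Z x a) (\val x) (\val x) by exact: val_path.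
have lp_pi (Z : set T) (x : set_type Z) (f : I -> T) : is_path Z f (\val x) (\val x) ->
    exists a : pi1 R x, homot Z (lp Z x a) f.
  move=> pf; have [p /funext pE] := lift_path pf.
  by exists (\pi_(pi1 R x) p); rewrite -pE; apply/homot_val/pi1_repr.
have lp_inj (Z : set T) (x : set_type Z) (a b : pi1 R x) :
    homot Z (lp Z x a) (lp Z x b) -> a = b.
  by move/homot_val/pi1P; rewrite !reprK.
have lp_mul (Z : set T) (x : set_type Z) (a b : pi1 R x) :
    homot Z (lp Z x (a * b)%g) (concat_fun (lp Z x a) (lp Z x b)).
  by rewrite /lp -val_concat homot_val; exact: pi1_repr.
(* The loop [b] is the conjugate of [a] by the path [c], written as [b c = c a] to avoid the reverse
   of [c]. *)
pose r (a : pi1 R d) (b : pi1 R e) :=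
  homot X (concat_fun (lp Y e b) c) (concat_fun c (lp X d a)).
have YXp (f : I -> T) x y : is_path Y f x y -> is_path X f x y by exact: is_pathS.
have pcV := is_path_rev pc.
apply: (@group_isomorphic_rel _ _ r) => [a|b|a b b' rab rab'|a a' b rab ra'b|a a' b b' rab ra'b'].
- have pa := lpP X d a.
  have [g pg kg] := path_homot_push basis YX
    (is_path_cat pc (is_path_cat pa pcV)) (set_valP e) (set_valP e).
  have [b bg] := lp_pi Y e g pg; exists b.
  have bk := homot_trans (homotS YX bg) (homot_sym kg); rewrite /r.
  apply: homot_trans (homot_catl (YXp _ _ _ (lpP Y e b)) pc bk) _.
  apply: homot_trans (homot_catA pc (is_path_cat pa pcV) pc) _.
  apply: (homot_catr pc (is_path_cat (is_path_cat pa pcV) pc) _).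
  apply: homot_trans (homot_catA pa pcV pc) _.
  apply: homot_trans (homot_catp1 pa).
  exact: homot_catr pa (is_path_cat pcV pc) (homot_catVp pc).
- have pb := YXp _ _ _ (lpP Y e b); have pbc := is_path_cat pb pc.
  have [a ak] := lp_pi X d _ (is_path_cat pcV pbc); exists a; rewrite /r.
  apply: homot_sym; apply: homot_trans (homot_catr pc (lpP X d a) ak) _.
  apply: homot_trans (homot_sym (homot_catA pc pcV pbc)) _.
  apply: homot_trans (homot_cat1p pbc).
  exact: homot_catl (is_path_cat pc pcV) pbc (homot_catpV pc).
- apply: lp_inj; apply: (homotopy_push basis (lpP Y e b) (lpP Y e b')).
  apply: (homot_cancelr (YXp _ _ _ (lpP Y e b)) (YXp _ _ _ (lpP Y e b')) pc _).
  exact: homot_trans rab (homot_sym rab').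
- apply: lp_inj; apply: (homot_cancell (lpP X d a) (lpP X d a') pc _).
  exact: homot_trans (homot_sym rab) ra'b.
- have pa := lpP X d a; have pa' := lpP X d a'.
  have pb := YXp _ _ _ (lpP Y e b); have pb' := YXp _ _ _ (lpP Y e b').
  have bb' := homotS YX (lp_mul Y e b b'); rewrite /r.
  apply: homot_trans (homot_catl (YXp _ _ _ (lpP Y e (b * b')%g)) pc bb') _.
  apply: homot_trans (homot_catA pb pb' pc) _.
  apply: homot_trans (homot_catr pb (is_path_cat pb' pc) ra'b') _.
  apply: homot_trans (homot_sym (homot_catA pb pc pa')) _.
  apply: homot_trans (homot_catl (is_path_cat pb pc) pa' rab) _.
  apply: homot_trans (homot_catA pc pa pa') _.
  apply: (homot_catr pc (is_path_cat pa pa') _).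
  exact: homot_sym (lp_mul X d a a').
Qed.

End Pi1Isomorphism.

(** * Divisors as images of labelled points *)

Lemma prod_continuous (Z : topologicalType) (K : eqType) (S : K -> topologicalType)
    (f : Z -> prod_topology S) :
  (forall i, continuous (fun z => f z i)) -> continuous f.
Proof.
move=> cf z; apply/cvg_sup => i U [] /= W [] [V oV <-] /= Vz WU.
apply: filterS WU _; apply: cf; exact: open_nbhs_nbhs.
Qed.

Section Configurations.
Context {V : finType} (k : V -> nat) (S : topologicalType).

Definition point_index : finType := {v : V & 'I_(k v)}.
Local Notation J := point_index.
Local Notation M := (sympow_prod k S).

Definition pindex (v : V) (i : 'I_(k v)) : J := Tagged (fun v => 'I_(k v)) i.

Definition divisor (z : J -> S) : M :=
  fun v => \pi_(sympow (k v) S) (fun i => z (pindex i)).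

Lemma divisor_surj d : exists z, divisor z = d.
Proof.
exists (fun j => repr (d (tag j)) (tagged j)); apply: functional_extensionality_dep => v.
by rewrite /divisor /= -[RHS]reprK.
Qed.

Definition colour_perm (s : forall v, 'S_(k v)) (j : J) : J :=
  pindex (s (tag j) (tagged j)).

Lemma divisorP (z z' : J -> S) : divisor z = divisor z' <->
  exists s, forall j, z' j = z (colour_perm s j).
Proof.
split=> [zz'|[s zs]].
  have sv v : exists s : 'S_(k v), forall i, z' (pindex i) = z (pindex (s i)).
    have /eqmodP/asboolP[s sE] := congr1 (fun d : M => d v) zz'.
    by exists s.
  exists (fun v => sval (cid (sv v))) => -[v i].
  exact: (svalP (cid (sv v)) i).
apply: functional_extensionality_dep => v; apply/eqmodP/asboolP.
by exists (s v) => i; rewrite zs.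
Qed.

Lemma mem_supp (z : J -> S) v x :
  supp (divisor z v) x <-> exists i : 'I_(k v), z (pindex i) = x.
Proof.
rewrite supp_pi; split=> [[i _ <-]|[i <-]]; first by exists i.
by exists i.
Qed.

Lemma divisor_continuous (Z : topologicalType) (z : Z -> J -> S) :
  (forall j, continuous (fun w => z w j)) -> continuous (fun w => divisor (z w)).
Proof.
move=> cz; apply: prod_continuous => v.
have cp : continuous (fun w => (fun i => z w (pindex i)) : {ptws 'I_(k v) -> S}).
  by apply: prod_continuous => i; exact: cz.
apply: (cts_comp cp); exact: pi_continuous.
Qed.

(** Labelled configurations are read as row vectors because neighbourhoods of a matrix are given
    entrywise: continuity of [divisor] then directly yields one neighbourhood per label. *)
Lemma divisor_nbhs (z : J -> S) O : nbhs (divisor z) O ->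
  exists2 N : J -> set S, (forall j, nbhs (z j) (N j)) &
    forall z', (forall j, N j (z' j)) -> O (divisor z').
Proof.
pose z_ (m : 'rV[S]_#|J|) (j : J) : S := m ord0 (enum_rank j).
have cz : continuous (fun m => divisor (z_ m)).
  apply: divisor_continuous => j m U nU.
  exists (fun i l => if (l == enum_rank j) then U else setT).
    move=> i l; case: eqP => [->|_]; last exact: filterT.
    by rewrite ord1.
  by move=> m' /(_ ord0 (enum_rank j)); rewrite eqxx.
pose m : 'rV[S]_#|J| := \row_l z (enum_val l).
have zm : z_ m = z by apply/funext => j; rewrite /z_ mxE enum_rankK.
rewrite -{1}zm => /cz[N nN NO].
exists (fun j => N ord0 (enum_rank j)) => [j|z' Nz'].
  by have := nN ord0 (enum_rank j); rewrite mxE enum_rankK.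
have := NO (\row_l z' (enum_val l)); rewrite /= /z_.
have -> : (fun j => (\row_l z' (enum_val l)) ord0 (enum_rank j)) = z'.
  by apply/funext => j; rewrite mxE enum_rankK.
apply=> i l; rewrite ord1 mxE; have := Nz' (enum_val l).
by rewrite enum_valK.
Qed.

(** The quotient map by a finite group of permutations is open. *)
Lemma divisor_open (z : J -> S) (N : J -> set S) : (forall j, nbhs (z j) (N j)) ->
  nbhs (divisor z) [set d | exists2 z', (forall j, N j (z' j)) & divisor z' = d].
Proof.
move=> nN.
(* The image of a product of open sets; its preimage is open because permuting the factors is
   continuous. *)
pose A v : set (sympow (k v) S) := [set c | exists2 x : 'I_(k v) -> S,
  (forall i, (N (pindex i))° (x i)) & \pi_(sympow (k v) S) x = c].
have oA v : open (A v).
  rewrite /open /= /quotient_open openE => y [x Nx /eqmodP/asboolP[s ys]].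
  have : \forall y' \near (y : {ptws 'I_(k v) -> S}), forall i,
      (N (pindex i))° (y' ((s^-1)%g i)).
    apply: (@filter_forall _ _ _ (nbhs (y : {ptws 'I_(k v) -> S})) (nbhs_filter _)) => i.
    apply: (@proj_continuous _ (fun _ : 'I_(k v) => S) ((s^-1)%g i) y).
    apply: open_nbhs_nbhs; split; first exact: open_interior.
    by rewrite /proj ys permKV.
  apply: (@filterS _ (nbhs (y : {ptws 'I_(k v) -> S})) (nbhs_filter _)) => y' Ny'.
  exists (fun i => y' ((s^-1)%g i)) => //.
  by apply/eqmodP/asboolP; exists s => i; rewrite permK.
have nA v : nbhs (divisor z) [set d : M | A v (d v)].
  apply: (@proj_continuous _ (fun v => sympow (k v) S : topologicalType) v (divisor z)).
  apply: open_nbhs_nbhs; split; first exact: oA.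
  by exists (fun i => z (pindex i)) => // i; exact: nN.
have := @filter_forall _ _ _ (nbhs (divisor z)) (nbhs_filter _) nA.
apply: (@filterS _ (nbhs (divisor z)) (nbhs_filter _)) => d Ad.
have {}Ad v : exists x : 'I_(k v) -> S, (forall i, N (pindex i) (x i)) /\
    \pi_(sympow (k v) S) x = d v.
  by have [x Nx xd] := Ad v; exists x; split=> // i; exact: interior_subset (Nx i).
exists (fun j => sval (cid (Ad (tag j))) (tagged j)) => [[v i]|] /=.
  by have [] := svalP (cid (Ad v)).
apply: functional_extensionality_dep => v.
by have [_ <-] := svalP (cid (Ad v)).
Qed.

End Configurations.

(** * Charts of a Riemann surface *)

Section Charts.
Context {R : realType}.
Local Notation C := (R[i]^o).
Local Notation P := (R^o * R^o)%type.

Lemma complex_ball (z : C) (e : R) : 0 < e -> nbhs z [set w : C | `|z - w| < e%:C%C].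
Proof. by move=> e0; apply: (@nbhsx_ballx _ C z); rewrite ltcR. Qed.

Lemma Re_continuous : continuous (fun w : C => complex.Re w : R^o).
Proof.
move=> z; apply/(@cvgrPdist_lt R R^o C (nbhs z) (nbhs_filter z)) => e e0.
apply: (@filterS _ (nbhs z) (nbhs_filter z) _ _ _ (complex_ball z e0)) => w zw.
by rewrite -raddfB /= -ltcR; apply: le_lt_trans (normc_ge_Re _) _.
Qed.

Lemma Im_continuous : continuous (fun w : C => complex.Im w : R^o).
Proof.
move=> z; apply/(@cvgrPdist_lt R R^o C (nbhs z) (nbhs_filter z)) => e e0.
apply: (@filterS _ (nbhs z) (nbhs_filter z) _ _ _ (complex_ball z e0)) => w zw.
rewrite -raddfB /= -ltcR; apply: le_lt_trans zw.
rewrite normc_def lecR -sqrtr_sqr ler_sqrt ?addr_ge0 ?sqr_ge0// lerDr.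
exact: sqr_ge0.
Qed.

Lemma complex_continuous : continuous (fun v : P => (v.1 +i* v.2)%C : C).
Proof.
move=> v; apply/(@cvgrPdist_lt _ C P (nbhs v) (nbhs_filter v)) => -[e e'].
rewrite ltcE /= => /andP[/eqP -> e0].
have e20 : 0 < e / 2 by rewrite divr_gt0.
have : \forall w \near v, ball v.1 (e / 2) w.1 /\ ball v.2 (e / 2) w.2.
  by exists (ball v.1 (e / 2), ball v.2 (e / 2)) => //=; split; exact: nbhsx_ballx.
apply: filterS => w [h1 h2]; rewrite /ball /= in h1 h2.
rewrite normc_def ltcR /= -(gtr0_norm e0) -sqrtr_sqr ltr_sqrt ?exprn_gt0//.
rewrite -real_normK ?num_real// -[X in _ + X < _]real_normK ?num_real//.
have := normr_ge0 (v.1 - w.1); have := normr_ge0 (v.2 - w.2).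
nra.
Qed.

(** Inverse homeomorphisms between the real line and the open interval of radius 1 around 0; they
    turn an open square of a chart into a plane. *)
Definition shrink (x : R) : R := x / (1 + `|x|).
Definition expand (y : R) : R := y / (1 - `|y|).

Lemma shrink_lt1 x : `|shrink x| < 1.
Proof.
rewrite /shrink normrM normfV (ger0_norm (addr_ge0 _ (normr_ge0 x)))//.
by rewrite ltr_pdivrMr ?ltr_pwDl// mul1r ltrDr.
Qed.

Lemma expandK y : `|y| < 1 -> shrink (expand y) = y.
Proof.
move=> y1; have h : 0 < 1 - `|y| by rewrite subr_gt0.
rewrite /shrink /expand normrM normfV (gtr0_norm h).
by field; rewrite subrK oner_eq0 gt_eqF.
Qed.

Lemma shrinkK x : expand (shrink x) = x.
Proof.
have h : 0 < 1 + `|x| by rewrite ltr_pwDl.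
rewrite /shrink /expand normrM normfV (gtr0_norm h); field.
by rewrite gt_eqF //= -addrA subrr addr0 oner_eq0.
Qed.

Lemma shrink_continuous : continuous (shrink : R^o -> R^o).
Proof.
move=> x; apply: cvgM; first exact: cvg_id.
apply: cvgV; first by rewrite gt_eqF// ltr_pwDl.
by apply: cvgD; [exact: cvg_cst|exact: norm_continuous].
Qed.

Lemma expand_continuous (y : R^o) : `|y| < 1 ->
  {for y, continuous (expand : R^o -> R^o)}.
Proof.
move=> y1; apply: cvgM; first exact: cvg_id.
apply: cvgV; first by rewrite gt_eqF// subr_gt0.
by apply: cvgB; [exact: cvg_cst|exact: norm_continuous].
Qed.

(** The parameters fill the whole plane, so that every segment between parameters is available. The
    last clause says that [psi] is an open map. *)
Definition planar_chart (S : topologicalType) (p : S) (psi : P -> S) :=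
  [/\ continuous psi, injective psi, psi (0, 0) = p &
      forall v N, nbhs v N -> nbhs (psi v) (psi @` N)].

(** Choose a square around the image of [p] in a chart, small enough to be sent into [O], and
    identify it with the plane by [shrink] in each coordinate. *)
Lemma planar_chart_exists (S : riemann_surface R) (p : S) (O : set S) :
  nbhs p O -> exists2 psi, planar_chart p psi & range psi `<=` O.
Proof.
move=> pO; have [c _ cp] := rs_atlas_cover p.
have oD := @chart_dom_open _ _ c; have oI := @chart_img_open _ _ c.
have cmap q : chart_dom c q -> {for q, continuous (chart_map c)}.
  have := @chart_map_continuous _ _ c; rewrite continuous_open_subspace//.
  by move=> cm Dq; apply: cm; rewrite inE.
have cinv w : chart_img c w -> {for w, continuous (chart_inv c)}.
  have := @chart_inv_continuous _ _ c; rewrite continuous_open_subspace//.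
  by move=> ci Iw; apply: ci; rewrite inE.
have mapK q : chart_dom c q -> chart_inv c (chart_map c q) = q.
  by move=> Dq; apply: (@chart_mapK _ _ c); rewrite inE.
have invK w : chart_img c w -> chart_dom c (chart_inv c w) /\ chart_map c (chart_inv c w) = w.
  by move=> [q Dq <-]; rewrite mapK.
pose z0 := chart_map c p.
pose a0 : R := complex.Re z0; pose b0 : R := complex.Im z0.
pose cplx (v : P) : C := (v.1 +i* v.2)%C.
have eta (z : C) : cplx (complex.Re z, complex.Im z) = z by case: z.
have [r r0 rO] : exists2 r : R, 0 < r & forall x y, `|x - a0| < r -> `|y - b0| < r ->
    chart_img c (cplx (x, y)) /\ O (chart_inv c (cplx (x, y))).
  have z0E : cplx (a0, b0) = z0 by exact: eta.
  have Iz0 : chart_img c z0 by exists p.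
  have nz0 : nbhs z0 (chart_img c `&` chart_inv c @^-1` O).
    apply: filterI; first exact: open_nbhs_nbhs.
    by apply: cinv Iz0 _ _; rewrite mapK.
  rewrite -z0E in nz0; have /= := complex_continuous nz0.
  move=> [[A B] [/= /nbhs_ballP[e1 /= e10 Ae] /nbhs_ballP[e2 /= e20 Be]] AB].
  exists (Num.min e1 e2); first by rewrite lt_min e10.
  move=> x y; rewrite !lt_min => /andP[xe _] /andP[_ ye].
  have /= := AB (x, y); apply; split => /=.
    by apply: Ae; rewrite /ball /= distrC.
  by apply: Be; rewrite /ball /= distrC.
pose emb (v : P) : P := (a0 + r * shrink v.1, b0 + r * shrink v.2).
pose psi v := chart_inv c (cplx (emb v)).
pose theta q : P := (expand ((complex.Re (chart_map c q) - a0) / r),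
                     expand ((complex.Im (chart_map c q) - b0) / r)).
have emb_in v : chart_img c (cplx (emb v)) /\ O (psi v).
  by apply: rO; rewrite addrAC subrr add0r normrM (gtr0_norm r0)
    gtr_pMr// shrink_lt1.
have map_psi v : chart_map c (psi v) = cplx (emb v).
  by have [/invK[]] := emb_in v.
have psiK : cancel psi theta.
  move=> v; rewrite /theta map_psi /= !(addrAC _ _ (- _)) !subrr !add0r.
  by rewrite ![r * _]mulrC !mulfK ?gt_eqF// !shrinkK -surjective_pairing.
have cpsi : continuous psi.
  move=> v; have cemb : continuous (fun v => cplx (emb v)).
    apply: (@cts_comp _ _ _ emb cplx); last exact: complex_continuous.
    apply: cts_pair; apply: cts_add; [exact: cts_cst| |exact: cts_cst|].
      apply: cts_mul; first exact: cts_cst.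
      exact: (cts_comp cts_fst shrink_continuous).
    apply: cts_mul; first exact: cts_cst.
    exact: (cts_comp cts_snd shrink_continuous).
  apply: (@continuous_comp _ _ _ (fun v => cplx (emb v)) (chart_inv c)).
    exact: cemb.
  by apply: cinv; case: (emb_in v).
exists psi; last by move=> _ [v _ <-]; case: (emb_in v).
split=> //; first exact: can_inj psiK.
  rewrite /psi /emb /= /shrink !mul0r !mulr0 !addr0.
  by rewrite -[RHS](mapK p cp); congr chart_inv; exact: eta.
move=> v N vN.
have [Dv _] := invK _ (emb_in v).1.
have cRe (q : S) : chart_dom c q -> {for q, continuous (fun q => complex.Re (chart_map c q) : R^o)}.
  move=> Dq; apply: (@continuous_comp _ _ _ (chart_map c)); first exact: cmap.
  exact: Re_continuous.
have cIm (q : S) : chart_dom c q -> {for q, continuous (fun q => complex.Im (chart_map c q) : R^o)}.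
  move=> Dq; apply: (@continuous_comp _ _ _ (chart_map c)); first exact: cmap.
  exact: Im_continuous.
pose u1 (q : S) : R^o := (complex.Re (chart_map c q) - a0) / r.
pose u2 (q : S) : R^o := (complex.Im (chart_map c q) - b0) / r.
have cu1 : {for psi v, continuous u1}.
  apply: (@cvgM _ _ (nbhs (psi v))); last exact: cvg_cst.
  by apply: (@cvgB _ _ _ (nbhs (psi v))); [exact: cRe|exact: cvg_cst].
have cu2 : {for psi v, continuous u2}.
  apply: (@cvgM _ _ (nbhs (psi v))); last exact: cvg_cst.
  by apply: (@cvgB _ _ _ (nbhs (psi v))); [exact: cIm|exact: cvg_cst].
have u1v : u1 (psi v) = shrink v.1.
  by rewrite /u1 map_psi /= (addrAC _ _ (- _)) subrr add0r mulrC mulKf// gt_eqF.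
have u2v : u2 (psi v) = shrink v.2.
  by rewrite /u2 map_psi /= (addrAC _ _ (- _)) subrr add0r mulrC mulKf// gt_eqF.
have ct1 : {for psi v, continuous (fun q => expand (u1 q) : R^o)}.
  apply: (@continuous_comp _ _ _ u1 (expand : R^o -> R^o)) => //.
  by apply: expand_continuous; rewrite u1v shrink_lt1.
have ct2 : {for psi v, continuous (fun q => expand (u2 q) : R^o)}.
  apply: (@continuous_comp _ _ _ u2 (expand : R^o -> R^o)) => //.
  by apply: expand_continuous; rewrite u2v shrink_lt1.
have ctheta : {for psi v, continuous theta}.
  exact: (@cvg_pair _ _ _ (nbhs (psi v)) (nbhs (expand (u1 (psi v)) : R^o))
    (nbhs (expand (u2 (psi v)) : R^o)) _ _ _ _ _ ct1 ct2).
(* Near [psi v] the rescaled coordinates stay in the interval on which [expand] inverts [shrink]. *)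
have small (u : S -> R^o) : {for psi v, continuous u} -> `|u (psi v)| < 1 ->
    nbhs (psi v) [set q | `|u q| < 1].
  move=> cu u1'.
  have cn : {for psi v, continuous (fun q => `|u q| : R^o)}.
    by apply: (@continuous_comp _ _ _ u (fun x : R^o => `|x| : R^o)) => //; exact: norm_continuous.
  by apply: (cn [set x : R^o | x < 1]); apply: open_nbhs_nbhs; split => //; exact: open_lt.
have n1 := small _ cu1; have n2 := small _ cu2.
rewrite u1v in n1; rewrite u2v in n2.
have nD : nbhs (psi v) (chart_dom c) by apply: open_nbhs_nbhs.
have nT : nbhs (psi v) (theta @^-1` N) by apply: ctheta; rewrite psiK.
apply: filterS (filterI nD (filterI nT (filterI (n1 (shrink_lt1 _)) (n2 (shrink_lt1 _))))).
move=> q [Dq [Nq [q1 q2]]]; exists (theta q) => //.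
rewrite /psi /emb /= -/(u1 q) -/(u2 q) !expandK// /u1 /u2.
rewrite ![r * _]mulrC !divfK ?gt_eqF// ![_ + (_ - _)]addrC !subrK.
by rewrite -[RHS](mapK q Dq) eta.
Qed.

(** The set of points reachable from [p] is open and closed, since each point has a neighbourhood
    all of whose points can be joined to it in a planar chart. *)
Lemma riemann_surface_path_connected (S : riemann_surface R) :
  connected [set: S] -> path_connected R [set: S].
Proof.
move=> conS.
have loc (q : S) : nbhs q [set q' | exists f : unit_interval R -> S, is_path setT f q q'].
  have [psi [cpsi _ psi0 opsi] _] := planar_chart_exists (@filterT _ (nbhs q) (nbhs_filter q)).
  have := opsi (0, 0) setT (@filterT _ (nbhs ((0, 0) : P)) (nbhs_filter _)).
  rewrite psi0.
  apply: (@filterS _ (nbhs q) (nbhs_filter q)) => _ [v _ <-].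
  exists (fun t => psi (ival t * v.1, ival t * v.2)); split=> //.
  - by apply: (cts_comp _ cpsi); cts.
  - by rewrite ival0 !mul0r.
  - by rewrite ival1 !mul1r -surjective_pairing.
move=> p q _ _; pose B : set S := [set q | exists f : unit_interval R -> S, is_path setT f p q].
suff BT : B = setT by have : B q by rewrite BT.
have oB : open B.
  rewrite openE => x [f pf]; apply: filterS (loc x) => y [g pg].
  by exists (concat_fun f g); exact: is_path_cat pf pg.
apply: conS.
- by exists p; exists (fun=> p); exact: is_path_cst.
- by exists B => //; rewrite setTI.
- exists B; last by rewrite setTI.
  rewrite -openC openE => x nBx; apply: filterS (loc x) => y [g pg] [f pf].
  by apply: nBx; exists (concat_fun f (reverse_fun g)); exact: is_path_cat pf (is_path_rev pg).
Qed.

End Charts.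

(** * General position *)

Section Generic.
Context {R : realType}.
Implicit Types P Q : R -> Prop.

(** Such a property fails at finitely many values at most; multiplying the polynomials gives finite
    conjunctions. *)
Definition generic P := exists2 p : {poly R}, p != 0 & forall x, p.[x] != 0 -> P x.

Lemma generic_imp P Q : (forall x, P x -> Q x) -> generic P -> generic Q.
Proof. by move=> PQ [p p0 pP]; exists p => // x /pP /PQ. Qed.

Lemma generic_and P Q : generic P -> generic Q -> generic (fun x => P x /\ Q x).
Proof.
move=> [p p0 pP] [q q0 qQ]; exists (p * q); first by rewrite mulf_neq0.
by move=> x; rewrite hornerM mulf_eq0 negb_or => /andP[/pP ? /qQ].
Qed.

Lemma generic_forall (I : finType) (P : I -> R -> Prop) :
  (forall i, generic (P i)) -> generic (fun x => forall i, P i x).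
Proof.
move=> gP; have /choice[p pP] : forall i, exists p : {poly R},
    p != 0 /\ forall x, p.[x] != 0 -> P i x.
  by move=> i; have [p ? ?] := gP i; exists p.
exists (\prod_i p i); first by apply/prodf_neq0 => i _; have [] := pP i.
move=> x; rewrite horner_prod => /prodf_neq0 px i; have [_] := pP i.
by apply; exact: px.
Qed.

Lemma generic_True P : (forall x, P x) -> generic P.
Proof. by move=> HP; exists 1; rewrite ?oner_neq0. Qed.

Lemma generic_ex P : generic P -> exists x, P x.
Proof.
move=> [p p0 pP]; apply: contrapT => nP.
have rootp x : root p x.
  by apply/negPn/negP => px; apply: nP; exists x; apply: pP.
(* If no value were suitable, the integers below [size p] would be too many roots of [p]. *)
have := @max_poly_roots _ p [seq i%:R | i <- iota 0 (size p)] p0.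
rewrite size_map size_iota ltnn => H; suff : false by []; apply: H.
  by apply/allP => x _.
by rewrite map_inj_uniq ?iota_uniq//; exact: (mulrIn (oner_neq0 R)).
Qed.

End Generic.

(** * Avoiding coincidences with points of a polynomial curve *)

Section GeneralPosition.
Context {R : realType}.
Local Notation P := (R^o * R^o)%type.

Definition mix {J : Type} (s : R) (u c : J -> P) (j : J) : P :=
  ((1 - s) * (u j).1 + s * (c j).1, (1 - s) * (u j).2 + s * (c j).2).

Lemma mix0 (J : Type) (u c : J -> P) : mix 0 u c = u.
Proof.
apply/funext => j; rewrite /mix subr0 !mul1r !mul0r !addr0.
by rewrite -surjective_pairing.
Qed.

Lemma mix1 (J : Type) (u c : J -> P) : mix 1 u c = c.
Proof.
apply/funext => j; rewrite /mix subrr !mul1r !mul0r !add0r.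
by rewrite -surjective_pairing.
Qed.

(** Distinct values of [n] use disjoint pairs of exponents, so the coordinates of points with
    distinct [n] are distinct monomials in [x]. *)
Definition curve_point (x : R) (n : nat) : P := (x ^+ n.*2.+1, x ^+ n.*2.+2).

(* Two points of R^4 lie on a hyperplane, which the curve does not stay in. *)
Lemma generic_triple (J : Type) (n : J -> nat) (v u : J -> P) (a b c : J) :
  n a != n b -> n b != n c -> n c != n a ->
  generic (fun x => forall s t, s != 0 ->
    let w := mix s (mix t v u) (fun j => curve_point x (n j)) in
    w a = w b -> w a = w c -> False).
Proof.
move=> ab bc ca.
pose D (w : J -> P) : 'cV[R]_4 := \col_i
  [:: (w a).1 - (w b).1; (w a).2 - (w b).2; (w a).1 - (w c).1; (w a).2 - (w c).2]`_i.
(* The matrix with columns [D v] and [D u] has four rows and rank at most 2, so some nonzero linear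
   form [l] kills both columns. *)
have [l l0 [lv lu]] : exists2 l : 'rV[R]_4, l != 0 & l *m D v = 0 /\ l *m D u = 0.
  pose A := row_mx (D v) (D u).
  have : kermx A != 0.
    rewrite -mxrank_eq0 mxrank_ker subn_eq0 -ltnNge.
    exact: leq_ltn_trans (rank_leq_col A) _.
  move=> /rowV0Pn[l /sub_kermxP lA l0]; exists l => //.
  by move: lA; rewrite mul_mx_row => /eqP; rewrite row_mx_eq0 => /andP[/eqP ? /eqP ?].
have scal w : l *m D w = 0 -> l ord0 0 * ((w a).1 - (w b).1) + l ord0 1 * ((w a).2 - (w b).2)
    + l ord0 2 * ((w a).1 - (w c).1) + l ord0 3 * ((w a).2 - (w c).2) = 0.
  move/matrixP/(_ ord0 ord0); rewrite !mxE !big_ord_recl big_ord0 !mxE /= => <-.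
  rewrite addr0 !addrA; congr (_ * _ + _ * _ + _ * _ + _ * _); congr (l _ _); exact/val_inj.
(* The value of the form [l] along the curve. *)
pose p : {poly R} := l ord0 0 *: ('X^((n a).*2.+1) - 'X^((n b).*2.+1))
  + l ord0 1 *: ('X^((n a).*2.+2) - 'X^((n b).*2.+2))
  + l ord0 2 *: ('X^((n a).*2.+1) - 'X^((n c).*2.+1))
  + l ord0 3 *: ('X^((n a).*2.+2) - 'X^((n c).*2.+2)).
have px x : p.[x] = l ord0 0 * (x ^+ (n a).*2.+1 - x ^+ (n b).*2.+1)
  + l ord0 1 * (x ^+ (n a).*2.+2 - x ^+ (n b).*2.+2)
  + l ord0 2 * (x ^+ (n a).*2.+1 - x ^+ (n c).*2.+1)
  + l ord0 3 * (x ^+ (n a).*2.+2 - x ^+ (n c).*2.+2).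
  by rewrite /p !hornerE.
exists p.
  apply: contra_neq l0 => p0; apply/rowP => i; rewrite mxE.
  have pk m : p`_m = 0 by rewrite p0 coef0.
  have oddeven (i1 i2 : nat) : (i1.*2.+1 == i2.*2.+2) = false by lia.
  have evenodd (i1 i2 : nat) : (i1.*2.+2 == i2.*2.+1) = false by lia.
  have odds (i1 i2 : nat) : (i1.*2.+1 == i2.*2.+1) = (i1 == i2) by lia.
  have evens (i1 i2 : nat) : (i1.*2.+2 == i2.*2.+2) = (i1 == i2) by lia.
  have [ba cb ac] : [/\ n b != n a, n c != n b & n a != n c].
    by split; rewrite eq_sym.
  (* The coefficients at the two exponents of [b] and the two exponents of [c] are the opposites of
     the four entries of [l]. *)
  have := pk (n b).*2.+1; have := pk (n b).*2.+2.
  have := pk (n c).*2.+1; have := pk (n c).*2.+2.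
  rewrite /p !(coefD, coefZ, coefN, coefXn) !(oddeven, evenodd, odds, evens).
  rewrite !eqxx ?(negPf ba) ?(negPf cb) ?(negPf ac) ?(negPf bc) ?(negPf ca) /=.
  rewrite ?subr0 ?sub0r ?oppr0 ?mulr0 ?addr0 ?add0r ?mulrN1 => l3 l2 l1 l0'.
  have li m (m4 : (m < 4)%N) : l ord0 (inord m) = 0.
    case: m m4 => [|[|[|[|//]]]] _; [move: l0'|move: l1|move: l2|move: l3];
      move/eqP; rewrite oppr_eq0 => /eqP <-; congr (l _ _); apply/val_inj;
      by rewrite /= inordK.
  by rewrite -(inord_val i); apply: li.
move=> x pxn s t s0 w wab wac; move/eqP: pxn; apply; rewrite px.
apply: (mulfI s0); rewrite mulr0.
have [[e1 e2] [e3 e4]] : ((w a).1 - (w b).1 = 0 /\ (w a).2 - (w b).2 = 0) /\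
    ((w a).1 - (w c).1 = 0 /\ (w a).2 - (w c).2 = 0).
  by rewrite -wab -wac !subrr.
set L := (X in X = 0).
(* By linearity, [s] times the value of [p] at [x] is [l] applied to [D w], up to the contributions
   of [v] and [u], which vanish. *)
have -> : L = l ord0 0 * ((w a).1 - (w b).1) + l ord0 1 * ((w a).2 - (w b).2)
    + l ord0 2 * ((w a).1 - (w c).1) + l ord0 3 * ((w a).2 - (w c).2)
  - (1 - s) * ((1 - t) * (l ord0 0 * ((v a).1 - (v b).1)
      + l ord0 1 * ((v a).2 - (v b).2) + l ord0 2 * ((v a).1 - (v c).1)
      + l ord0 3 * ((v a).2 - (v c).2))
    + t * (l ord0 0 * ((u a).1 - (u b).1) + l ord0 1 * ((u a).2 - (u b).2)
      + l ord0 2 * ((u a).1 - (u c).1) + l ord0 3 * ((u a).2 - (u c).2))).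
  by rewrite /L /w /mix /curve_point /=; ring.
by rewrite e1 e2 e3 e4 (scal _ lv) (scal _ lu) !mulr0 !addr0 mulr0 subr0.
Qed.

(** The same argument in the plane: one vector lies on a line through the origin, in which the curve
    does not stay. *)
Lemma generic_pair (J : Type) (n : J -> nat) (v : J -> P) (a b : J) :
  n a != n b ->
  generic (fun x => forall s, s != 0 ->
    let w := mix s v (fun j => curve_point x (n j)) in w a = w b -> False).
Proof.
move=> ab; have ba : n b != n a by rewrite eq_sym.
pose d1 := (v a).1 - (v b).1; pose d2 := (v a).2 - (v b).2.
(* Take the form orthogonal to the difference vector, or any nonzero form when this vector
   vanishes. *)
have [l1 [l2 [l0 ld]]] : exists l1 l2 : R, (l1, l2) != (0, 0) /\ l1 * d1 + l2 * d2 = 0.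
  have [dd|dd] := eqVneq (d1, d2) (0, 0).
    exists 1, 0; split; first by rewrite xpair_eqE oner_eq0.
    by case: dd => -> _; rewrite mulr0 mul0r addr0.
  exists d2, (- d1); split; last by ring.
  by move: dd; rewrite !xpair_eqE oppr_eq0 andbC.
pose p : {poly R} := l1 *: ('X^((n a).*2.+1) - 'X^((n b).*2.+1))
  + l2 *: ('X^((n a).*2.+2) - 'X^((n b).*2.+2)).
have px x : p.[x] = l1 * (x ^+ (n a).*2.+1 - x ^+ (n b).*2.+1)
  + l2 * (x ^+ (n a).*2.+2 - x ^+ (n b).*2.+2).
  by rewrite /p !hornerE.
exists p.
  apply: contra_neq l0 => p0.
  have pk m : p`_m = 0 by rewrite p0 coef0.
  have oddeven (i1 i2 : nat) : (i1.*2.+1 == i2.*2.+2) = false by lia.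
  have evenodd (i1 i2 : nat) : (i1.*2.+2 == i2.*2.+1) = false by lia.
  have odds (i1 i2 : nat) : (i1.*2.+1 == i2.*2.+1) = (i1 == i2) by lia.
  have evens (i1 i2 : nat) : (i1.*2.+2 == i2.*2.+2) = (i1 == i2) by lia.
  have := pk (n b).*2.+1; have := pk (n b).*2.+2.
  rewrite /p !(coefD, coefZ, coefN, coefXn) !(oddeven, evenodd, odds, evens).
  rewrite !eqxx (negPf ba) /=.
  rewrite ?subr0 ?sub0r ?oppr0 ?mulr0 ?addr0 ?add0r ?mulrN1.
  by move=> /eqP; rewrite oppr_eq0 => /eqP -> /eqP; rewrite oppr_eq0 => /eqP ->.
move=> x pxn s s0 w wab; move/eqP: pxn; apply; rewrite px.
apply: (mulfI s0); rewrite mulr0.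
have [e1 e2] : (w a).1 - (w b).1 = 0 /\ (w a).2 - (w b).2 = 0.
  by rewrite -wab !subrr.
set L := (X in X = 0).
have -> : L = l1 * ((w a).1 - (w b).1) + l2 * ((w a).2 - (w b).2)
  - (1 - s) * (l1 * d1 + l2 * d2).
  by rewrite /L /w /mix /curve_point /d1 /d2 /=; ring.
by rewrite e1 e2 ld !mulr0 addr0 subr0.
Qed.

End GeneralPosition.

(** * Divisors near a given divisor *)

Section LocalCell.
Context {R : realType} {V : finType} (k : V -> nat) (S : topologicalType).
Local Notation I := (unit_interval R).
Local Notation P := (R^o * R^o)%type.
Local Notation J := (point_index k).
Local Notation M := (sympow_prod k S).
Implicit Types (u v c : J -> P) (L : simplicial_complex V).

Variables (z0 : J -> S) (psi : J -> P -> S).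
Hypothesis psi_chart : forall j, planar_chart (z0 j) (psi j).
Hypothesis psi_eq : forall i j, z0 i = z0 j -> psi i = psi j.
Hypothesis psi_disj : forall i j x y, psi i x = psi j y -> z0 i = z0 j.

Definition cell_map v : M := divisor (fun j => psi j (v j)).

(** Same colour and same disc: only such labels are exchanged between two labellings of a divisor of
    the cell. *)
Definition same (i j : J) : bool := (tag i == tag j) && `[< z0 i = z0 j >].

Lemma psi_inj i j x y : psi i x = psi j y -> x = y.
Proof.
move=> e; have /psi_eq ij := psi_disj e.
by move: e; rewrite ij; have [_ inj _ _] := psi_chart j; exact: inj.
Qed.

Lemma cell_mapP u v : cell_map u = cell_map v ->
  exists s, forall j, same j (colour_perm s j) /\ v j = u (colour_perm s j).
Proof.
move=> /divisorP[s uv]; exists s => j; split; last exact: psi_inj (uv j).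
by rewrite /same /= eqxx; apply/asboolP; exact: psi_disj (uv j).
Qed.

(* The straight-line contraction to [c] is well defined on the divisors with a
   representative in [B]. *)
Definition compatible (B : set (J -> P)) c :=
  forall u v i j, B u -> B v -> same i j -> v i = u j -> c i = c j.

(** The permutation matching [u] with [v] also matches their mixtures with [c]. *)
Lemma cell_map_mix B c u v s : compatible B c -> B u -> B v ->
  cell_map u = cell_map v -> cell_map (mix s u c) = cell_map (mix s v c).
Proof.
move=> Bc Bu Bv /cell_mapP[g ug]; apply/divisorP; exists g => j.
have [gj vj] := ug j; have cj := Bc _ _ _ _ Bu Bv gj vj.
rewrite /mix vj cj; have /andP[_ /asboolP/psi_eq <-//] := gj.
Qed.

Lemma cell_map_continuous (Z : topologicalType) (f : Z -> J -> P) :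
  (forall j, continuous (fun w => f w j)) -> continuous (fun w => cell_map (f w)).
Proof.
move=> cf; apply: divisor_continuous => j; apply: (cts_comp (cf j)).
by have [] := psi_chart j.
Qed.

Lemma cell_map_open u (N : J -> set P) : (forall j, nbhs (u j) (N j)) ->
  nbhs (cell_map u) [set d | exists2 v, (forall j, N j (v j)) & cell_map v = d].
Proof.
move=> nN; have := @divisor_open V k S (fun j => psi j (u j)) (fun j => psi j @` N j).
move=> H; have {}H := H (fun j => let: And4 _ _ _ o := psi_chart j in o _ _ (nN j)).
apply: (@filterS _ (nbhs (cell_map u)) (nbhs_filter _) _ _ _ H) => d [z' Nz' <-].
have /choice[v Hv] : forall j, exists x, N j x /\ psi j x = z' j.
  by move=> j; have [x Nx xz] := Nz' j; exists x.
exists v; first by move=> j; have [] := Hv j.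
by congr divisor; apply/funext => j; have [_] := Hv j.
Qed.

Lemma mix_continuous (Z : topologicalType) (r : Z -> R^o) (f g : Z -> J -> P) :
  continuous r -> (forall j, continuous (fun w => f w j)) ->
  (forall j, continuous (fun w => g w j)) ->
  forall j, continuous (fun w => mix (r w) (f w) (g w) j).
Proof.
move=> cr cf cg j; rewrite /mix.
have c1 : continuous (fun w => (f w j).1) by exact: (cts_comp (cf j) cts_fst).
have c2 : continuous (fun w => (f w j).2) by exact: (cts_comp (cf j) cts_snd).
have c3 : continuous (fun w => (g w j).1) by exact: (cts_comp (cg j) cts_fst).
have c4 : continuous (fun w => (g w j).2) by exact: (cts_comp (cg j) cts_snd).
by cts.
Qed.

(** No continuous labelling of [f] is required: labels are chosen at each time separately, and the
    result is independent of the choice. Near a given time, openness of [cell_map] provides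
    labellings close to a fixed one, whence continuity. *)
Lemma contraction (B : J -> set P) c (f : I -> M) :
  (forall j, open (B j)) -> compatible [set u | forall j, B j (u j)] c ->
  continuous f -> (forall t, exists2 u, (forall j, B j (u j)) & cell_map u = f t) ->
  exists2 H : I * I -> M, continuous H & forall t s u, (forall j, B j (u j)) ->
    cell_map u = f t -> H (t, s) = cell_map (mix (ival s) u c).
Proof.
move=> oB Bc cf fB.
have /choice[l Hl] : forall t, exists u, (forall j, B j (u j)) /\ cell_map u = f t.
  by move=> t; have [u ? ?] := fB t; exists u.
have HE t s u : (forall j, B j (u j)) -> cell_map u = f t ->
    cell_map (mix s (l t) c) = cell_map (mix s u c).
  by move=> Bu uf; have [Bl lf] := Hl t; apply: (cell_map_mix s Bc Bl Bu); rewrite lf uf.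
exists (fun w => cell_map (mix (ival w.2) (l w.1) c)); last by move=> t s u; exact: HE.
move=> [t s] O nO; have [N nN NO] := divisor_nbhs nO; have [Bl lf] := Hl t.
have /choice[AE HAE] : forall j, exists AE : set P * set I,
    [/\ nbhs (l t j) AE.1, nbhs s AE.2 & forall x s', AE.1 x -> AE.2 s' ->
      N j (psi j ((1 - ival s') * x.1 + ival s' * (c j).1,
                  (1 - ival s') * x.2 + ival s' * (c j).2))].
  move=> j; pose g (w : P * I) := psi j ((1 - ival w.2) * w.1.1 + ival w.2 * (c j).1,
                  (1 - ival w.2) * w.1.2 + ival w.2 * (c j).2).
  have cg : continuous g.
    apply: cts_comp; last by have [] := psi_chart j.
    by cts.
  have := cg (l t j, s) _ (nN j); move=> [[A E] [/= nA nE] AEN].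
  exists (A, E); split=> // x s' Ax Es'; exact: (AEN (x, s')).
have nt : nbhs t [set t' | exists2 v, (forall j, (B j `&` (AE j).1) (v j)) & cell_map v = f t'].
  apply: (cf t [set d | exists2 v, (forall j, (B j `&` (AE j).1) (v j)) & cell_map v = d]).
  rewrite -lf; apply: (@cell_map_open (l t) (fun j => B j `&` (AE j).1)) => j.
  apply: filterI; last by have [] := HAE j.
  exact: open_nbhs_nbhs.
have ns : nbhs s [set s' | forall j, (AE j).2 s'].
  apply: (@filter_forall _ _ _ (nbhs s) (nbhs_filter _)) => j.
  by have [] := HAE j.
exists ([set t' | exists2 v, (forall j, (B j `&` (AE j).1) (v j)) & cell_map v = f t'],
        [set s' | forall j, (AE j).2 s']) => //.
move=> [t' s'] [/= [v Bv vf] Es']; rewrite (HE _ _ v)//; last first.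
  by move=> j; have [] := Bv j.
by apply: NO => j; have [_ _] := HAE j; apply => //; have [] := Bv j.
Qed.

Local Notation D L := (@braiding_divisors V k S L).

Lemma not_braiding L v : ~ D L (cell_map v) -> exists (s : {set V}) (f : V -> J),
  [/\ s != finset.set0, s \notin simplices L, forall w, w \in s -> tag (f w) = w &
   forall w w', w \in s -> w' \in s -> z0 (f w) = z0 (f w') /\ v (f w) = v (f w')].
Proof.
move=> /existsNP[s] /not_implyP[s0] /not_implyP[sL] /eqP/set0P[x Hx].
(* A colour outside [s] may carry no label, hence the option; such colours are later sent to a label
   of [w0]. *)
have /choice[f Hf] : forall w, exists j : option J,
    w \in s -> exists2 i : 'I_(k w), j = Some (pindex i) & psi (pindex i) (v (pindex i)) = x.
  move=> w; case: (boolP (w \in s)) => [ws|_]; last by exists None.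
  by have /mem_supp[i ix] := Hx w ws; exists (Some (pindex i)) => _; exists i.
have /finset.set0Pn[w0 w0s] := s0; have [i0 fw0 _] := Hf w0 w0s.
pose g w := odflt (pindex i0) (f w).
have Hg w : w \in s -> tag (g w) = w /\ psi (g w) (v (g w)) = x.
  by move=> ws; rewrite /g; have [i -> ix] := Hf w ws.
exists s, g; split=> // [w /Hg[]//|w w' /Hg[_ gx] /Hg[_ gx']].
have e : psi (g w) (v (g w)) = psi (g w') (v (g w')) by rewrite gx.
by split; [exact: psi_disj e|exact: psi_inj e].
Qed.

Lemma braidingN L (z : J -> S) (s : {set V}) (f : V -> J) :
  s != finset.set0 -> s \notin simplices L -> (forall w, w \in s -> tag (f w) = w) ->
  (forall w w', w \in s -> w' \in s -> z (f w) = z (f w')) -> ~ D L (divisor z).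
Proof.
move=> s0 sL ft zf /(_ s s0 sL) /seteqP[+ _].
have /finset.set0Pn[w0 w0s] := s0.
move=> /(_ (z (f w0))); apply => w ws; apply/mem_supp.
rewrite (zf w0 w)//; have := ft w ws; case: (f w) => w' i /= e.
by move: i; rewrite e => i; exists i.
Qed.

(** The rank of a representative of the class of [j] under [same]: it is constant on classes and
    separates colours. *)
Definition label_rank (j : J) : nat := enum_rank (odflt j [pick i | same i j]).

Lemma same_label_rank i j : same i j -> label_rank i = label_rank j.
Proof.
move=> /andP[/eqP tij /asboolP zij]; rewrite /label_rank.
have -> : [pick l | same l i] = [pick l | same l j].
  by apply: eq_pick => l; rewrite /same tij zij.
case: pickP => // /(_ j) /negP[]; rewrite /same eqxx /=; exact/asboolP.
Qed.

Lemma label_rank_tag i j : label_rank i = label_rank j -> tag i = tag j.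
Proof.
have rank_tag l : tag (odflt l [pick m | same m l]) = tag l.
  by case: pickP => // m /andP[/eqP].
by move/val_inj/enum_rank_inj => e; rewrite -rank_tag e rank_tag.
Qed.

(* A point with the same coordinates at indices of the same colour near the
   same point of the surface: the contraction to it is defined everywhere. *)
Definition hub (x : R) (j : J) : P := curve_point x (label_rank j).

Lemma hub_compatible B x : compatible B (hub x).
Proof. by move=> u v i j _ _ ij _; rewrite /hub (same_label_rank ij). Qed.

(** * Segments and triangles ending at a hub *)

Definition segment u v (t : I) : M := cell_map (mix (ival t) u v).

Lemma segment_hub u v x : cell_map u = cell_map v -> segment u (hub x) = segment v (hub x).
Proof.
move=> uv; apply/funext => t.
exact: (cell_map_mix _ (@hub_compatible setT x) Logic.I Logic.I uv).
Qed.

Lemma segment_continuous u v : continuous (segment u v).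
Proof.
apply: cell_map_continuous; apply: mix_continuous; last 2 first.
- by move=> j; exact: cts_cst.
- by move=> j; exact: cts_cst.
- exact: ival_continuous.
Qed.

Lemma segment_path A u v : (forall t : I, A (segment u v t)) ->
  is_path A (segment u v) (cell_map u) (cell_map v).
Proof.
move=> uvA; split=> //; first exact: segment_continuous.
  by rewrite /segment ival0 mix0.
by rewrite /segment ival1 mix1.
Qed.

(** Since single vertices are simplices, a forbidden set has at least two colours, so it suffices to
    avoid coincidences of pairs. The start of the segment is excluded: [v] itself need not give a
    braiding divisor. *)
Lemma generic_segment L v :
  generic (fun x => forall s, s != 0 -> D L (cell_map (mix s v (hub x)))).
Proof.
have : generic (fun x => forall ij : J * J, tag ij.1 != tag ij.2 ->
    forall s, s != 0 -> mix s v (hub x) ij.1 = mix s v (hub x) ij.2 -> False).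
  apply: generic_forall => -[i j] /=; case: (eqVneq (tag i) (tag j)) => ij.
    exact: generic_True.
  have nij : label_rank i != label_rank j by apply: contra_neq ij => /label_rank_tag.
  by apply: generic_imp (generic_pair v nij) => x Hx _.
apply: generic_imp => x Hx s s0.
apply: contrapT => /not_braiding[e [f [e0 eL ft fc]]].
have /card_gt1P[w [w' [we we' ww']]] : (1 < #|e|)%N.
  rewrite ltn_neqAle card_gt0 e0 andbT eq_sym; apply: contraNneq eL => /eqP/cards1P[y ->].
  exact: simplex_vertex.
apply: (Hx (f w, f w') _ s s0) => /=; first by rewrite !ft.
by have [] := fc _ _ we we'.
Qed.

(* Every coincidence forbidden by [L] near the divisor [z0] involves at least
   three colours, hence has real codimension at least 4. *)
Definition triple_forbidden L := forall (s : {set V}) (f : V -> J),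
  s != finset.set0 -> s \notin simplices L -> (forall w, w \in s -> tag (f w) = w) ->
  (forall w w', w \in s -> w' \in s -> z0 (f w) = z0 (f w')) -> (2 < #|s|)%N.

(** The side [s = 0] of the triangle is covered by the hypothesis on the segment; elsewhere a
    forbidden coincidence would involve three colours, which [generic_triple] excludes. *)
Lemma generic_triangle L u v : triple_forbidden L ->
  (forall t : I, D L (segment u v t)) ->
  generic (fun x => forall s (t : I), D L (cell_map (mix s (mix (ival t) u v) (hub x)))).
Proof.
move=> L3 Duv; have : generic (fun x => forall abc : J * J * J,
    tag abc.1.1 != tag abc.1.2 -> tag abc.1.2 != tag abc.2 -> tag abc.2 != tag abc.1.1 ->
    forall s t, s != 0 -> let m := mix s (mix t u v) (hub x) in
      m abc.1.1 = m abc.1.2 -> m abc.1.1 = m abc.2 -> False).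
  apply: generic_forall => -[[a b] c] /=.
  case: (eqVneq (tag a) (tag b)) => ab; first exact: generic_True.
  case: (eqVneq (tag b) (tag c)) => bc; first exact: generic_True.
  case: (eqVneq (tag c) (tag a)) => ca; first exact: generic_True.
  have n i j : tag i != tag j -> label_rank i != label_rank j.
    by apply: contra_neq => /label_rank_tag.
  by apply: generic_imp (generic_triple u v (n _ _ ab) (n _ _ bc) (n _ _ ca)) => x Hx _ _ _.
apply: generic_imp => x Hx s t; have [->|s0] := eqVneq s 0; first by rewrite mix0; exact: Duv.
apply: contrapT => /not_braiding[e [f [e0 eL ft fc]]].
have /card_gt2P[w1 [w2 [w3 [[e1 e2 e3] [n12 n23 n31]]]]] : (2 < #|e|)%N.
  by apply: (L3 e f) => // w w' we we'; have [] := fc _ _ we we'.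
apply: (Hx (f w1, f w2, f w3) _ _ _ s (ival t) s0); rewrite /= ?ft//.
  by have [] := fc _ _ e1 e2.
by have [] := fc _ _ e1 e3.
Qed.

(** The triangle is a square one side of which is collapsed to the hub, so [homot_square]
    applies. *)
Lemma generic_triangle_homot L u v : triple_forbidden L ->
  (forall t : I, D L (segment u v t)) ->
  generic (fun x => homot (D L) (concat_fun (segment u v) (segment v (hub x)))
                                (segment u (hub x))).
Proof.
move=> L3 Duv; have := generic_triangle L3 Duv; apply: generic_imp => x Hx.
pose K (z : I * I) := cell_map (mix (ival z.2) (mix (ival z.1) u v) (hub x)).
have cK : continuous K.
  apply: cell_map_continuous; apply: mix_continuous.
  - by cts.
  - apply: mix_continuous; first by cts.
      by move=> j; exact: cts_cst.
    by move=> j; exact: cts_cst.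
  - by move=> j; exact: cts_cst.
have sq := homot_square cK (fun z => Hx (ival z.2) z.1).
have pu : is_path (D L) (segment u (hub x)) (cell_map u) (cell_map (hub x)).
  by apply: segment_path => t; have := Hx (ival t) zero; rewrite ival0 mix0.
apply: homot_trans (homot_catp1 pu).
move: sq; rewrite /K.
have -> : (fun t : I => cell_map (mix (ival (zero : I)) (mix (ival t) u v) (hub x))) =
    segment u v by apply/funext => t; rewrite ival0 mix0.
have -> : (fun t : I => cell_map (mix (ival t) (mix (ival (one : I)) u v) (hub x))) =
    segment v (hub x) by apply/funext => t; rewrite ival1 mix1.
have -> : (fun t : I => cell_map (mix (ival t) (mix (ival (zero : I)) u v) (hub x))) =
    segment u (hub x) by apply/funext => t; rewrite ival0 mix0.
have -> // : (fun t : I => cell_map (mix (ival (one : I)) (mix (ival t) u v) (hub x))) =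
    fun=> cell_map (hub x) by apply/funext => t; rewrite ival1 mix1.
Qed.

Lemma generic_segment_path L v : D L (cell_map v) ->
  generic (fun x => is_path (range cell_map `&` D L) (segment v (hub x))
                            (cell_map v) (cell_map (hub x))).
Proof.
move=> Dv; apply: generic_imp (generic_segment L v) => x Hx.
apply: segment_path => t; split; first by exists (mix (ival t) v (hub x)).
rewrite /segment; have [->|t0] := eqVneq (ival t) 0; first by rewrite mix0.
exact: Hx.
Qed.

(** Any two divisors of the cell are joined through a hub that is generic for both. A generic hub is
    itself a braiding divisor, being the end of a generic segment. *)
Lemma cell_dense L :
  range cell_map `&` D L !=set0 /\ path_connected R (range cell_map `&` D L).
Proof.
split.
  have [x Hx] := generic_ex (generic_segment L (fun=> (0, 0))).
  exists (cell_map (hub x)); split; first by exists (hub x).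
  by have := Hx 1 (oner_neq0 _); rewrite mix1.
move=> _ _ [[u _ <-] Du] [[v _ <-] Dv].
have [x [pu pv]] := generic_ex (generic_and (generic_segment_path Du) (generic_segment_path Dv)).
by exists (concat_fun (segment u (hub x)) (reverse_fun (segment v (hub x))));
  exact: is_path_cat pu (is_path_rev pv).
Qed.

Lemma cell_open : open (range cell_map).
Proof.
rewrite openE => _ [v _ <-].
have := @cell_map_open v (fun=> setT) (fun j => @filterT _ (nbhs (v j)) (nbhs_filter _)).
by apply: (@filterS _ (nbhs (cell_map v)) (nbhs_filter _)) => d [u _ <-]; exists u.
Qed.

(** * Small boxes and the comparison of paths with segments *)

Definition box (e : R) v (j : J) : set P :=
  [set x | `|x.1 - (v j).1| < e /\ `|x.2 - (v j).2| < e].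

Lemma box_open e v j : open (box e v j).
Proof.
have c1 : continuous (fun x : P => `|x.1 - (v j).1| : R^o).
  apply: (@cts_comp _ _ _ (fun x : P => x.1 - (v j).1 : R^o) (fun x : R^o => `|x| : R^o)).
    by cts.
  exact: norm_continuous.
have c2 : continuous (fun x : P => `|x.2 - (v j).2| : R^o).
  apply: (@cts_comp _ _ _ (fun x : P => x.2 - (v j).2 : R^o) (fun x : R^o => `|x| : R^o)).
    by cts.
  exact: norm_continuous.
have ol := @open_lt R e.
by apply: openI; [exact: (open_comp (fun x _ => c1 x) ol)|exact: (open_comp (fun x _ => c2 x) ol)].
Qed.

Lemma box_mix e v u s : 0 < e -> 0 <= s <= 1 -> (forall j, box e v j (u j)) ->
  forall j, box e v j (mix s u v j).
Proof.
move=> e0 /andP[s0 s1] Bu j; have [h1 h2] := Bu j; rewrite /box /mix /=.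
have key (a b : R) : `|a - b| < e -> `|(1 - s) * a + s * b - b| < e.
  move=> ab; have -> : (1 - s) * a + s * b - b = (1 - s) * (a - b) by ring.
  rewrite normrM ger0_norm ?subr_ge0//; apply: le_lt_trans ab.
  by rewrite ler_piMl// gerBl.
by split; exact: key.
Qed.

Lemma separating_box v : exists2 e : R, 0 < e &
  forall i j x, box e v i x -> box e v j x -> v i = v j.
Proof.
have : \forall e \near (0 : R)^'+, forall ij : J * J, forall x,
    box e v ij.1 x -> box e v ij.2 x -> v ij.1 = v ij.2.
  apply: filter_forall => -[i j] /=.
  have [vij|vij] := eqVneq (v i) (v j); first exact: nearW.
  pose d := `|(v i).1 - (v j).1| + `|(v i).2 - (v j).2|.
  have d0 : 0 < d.
    rewrite lt_neqAle addr_ge0// andbT eq_sym paddr_eq0// !normr_eq0 !subr_eq0.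
    by move: vij; case: (v i) => a b; case: (v j) => a' b'; rewrite xpair_eqE.
  (* A common point of the two boxes would give [d < 4 * e]. *)
  have d40 : 0 < d / 4 by rewrite divr_gt0.
  apply: filterS (nbhs_right_lt d40) => e ed x [h1 h2] [h3 h4]; exfalso.
  have t1 := ler_distD x.1 (v i).1 (v j).1; have t2 := ler_distD x.2 (v i).2 (v j).2.
  rewrite distrC in h1; rewrite distrC in h2.
  by rewrite /d in ed; lra.
move=> He; have [e [e0 {}He]] := filter_ex (filterI (nbhs_right_gt (0 : R)) He).
by exists e => // i j; exact: (He (i, j)).
Qed.

(** Points of [u] that coincide come from equal positions in [v], so moving inside the boxes creates
    no coincidence that [v] does not have. *)
Lemma box_divisors L v e : D L (cell_map v) ->
  (forall i j x, box e v i x -> box e v j x -> v i = v j) ->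
  forall u, (forall j, box e v j (u j)) -> D L (cell_map u).
Proof.
move=> Dv sep u Bu; apply: contrapT => /not_braiding[s [f [s0 sL ft fc]]].
apply: (@braidingN L (fun j => psi j (v j)) s f) Dv => // w w' ws ws'.
have [zw uw] := fc _ _ ws ws'; rewrite (psi_eq zw); congr psi.
by apply: (sep _ _ (u (f w))); [exact: Bu|rewrite uw; exact: Bu].
Qed.

(** All labellings of the ends are allowed, but one suffices for the proof, because a segment to a
    hub depends only on the divisor from which it starts. *)
Definition pulls_to_hub L (f : I -> M) x := forall u v,
  cell_map u = f zero -> cell_map v = f one ->
  homot (D L) (concat_fun f (segment v (hub x))) (segment u (hub x)).

Lemma pulls_to_hubW L (f : I -> M) x u v : cell_map u = f zero -> cell_map v = f one ->
  homot (D L) (concat_fun f (segment v (hub x))) (segment u (hub x)) ->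
  pulls_to_hub L f x.
Proof.
move=> uf vf huv u' v' u'f v'f.
by rewrite (@segment_hub v' v) ?(@segment_hub u' u)// ?v'f ?u'f.
Qed.

(** Contracting [f] to the centre [v] compares it with the segments from its ends to [v]; the
    triangles spanned by these segments and the hub then replace [v] by the hub. *)
Lemma box_pulls_to_hub L (e : R) v (f : I -> M) : triple_forbidden L -> 0 < e -> D L (cell_map v) ->
  (forall i j x, box e v i x -> box e v j x -> v i = v j) -> continuous f ->
  (forall t, exists2 u, (forall j, box e v j (u j)) & cell_map u = f t) ->
  generic (pulls_to_hub L f).
Proof.
move=> L3 e0 Dv sep cf fB.
have vB : compatible [set u | forall j, box e v j (u j)] v.
  move=> u u' i j Bu Bu' _ uu'; apply: (sep _ _ (u' i)); first exact: Bu'.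
  by rewrite uu'; exact: Bu.
have [H cH HE] := contraction (fun j => @box_open e v j) vB cf fB.
have DB s u : 0 <= s <= 1 -> (forall j, box e v j (u j)) -> D L (cell_map (mix s u v)).
  by move=> s01 Bu; apply: (box_divisors Dv sep); exact: box_mix.
have DH z : D L (H z).
  case: z => t s; have [u Bu uf] := fB t; rewrite (HE _ _ u)//.
  by apply: DB => //; exact: ival_itv.
have [u0 Bu0 u0f] := fB zero; have [u1 Bu1 u1f] := fB one.
have seg u (Bu : forall j, box e v j (u j)) : forall t : I, D L (segment u v t).
  by move=> t; apply: DB => //; exact: ival_itv.
have := homot_square cH DH.
have -> : (fun t => H (t, zero)) = f.
  by apply/funext => t; have [u Bu uf] := fB t; rewrite (HE _ _ u)// ival0 mix0.
have -> : (fun t => H (one, t)) = segment u1 v.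
  by apply/funext => t; rewrite (HE _ _ u1).
have -> : (fun t => H (zero, t)) = segment u0 v.
  by apply/funext => t; rewrite (HE _ _ u0).
have -> : (fun t => H (t, one)) = fun=> cell_map v.
  by apply/funext => t; have [u Bu uf] := fB t; rewrite (HE _ _ u)// ival1 mix1.
move=> sq; have p0 := segment_path (seg _ Bu0); have p1 := segment_path (seg _ Bu1).
have fD t : D L (f t).
  by have [u Bu <-] := fB t; apply: (box_divisors Dv sep).
have pf : is_path (D L) f (cell_map u0) (cell_map u1) by split.
have {}sq : homot (D L) (concat_fun f (segment u1 v)) (segment u0 v).
  exact: homot_trans sq (homot_catp1 p0).
have := generic_and (generic_and (generic_segment_path Dv)
  (generic_segment_path (box_divisors Dv sep Bu1)))
  (generic_and (generic_triangle_homot L3 (seg _ Bu0)) (generic_triangle_homot L3 (seg _ Bu1))).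
apply: generic_imp => x [[pv' p1'] [h0 h1]]; apply: (pulls_to_hubW u0f u1f).
have pv := is_pathS (@subIsetr _ _ _) pv'; have p1x := is_pathS (@subIsetr _ _ _) p1'.
apply: homot_trans (homot_catr pf p1x (homot_sym h1)) _.
apply: homot_trans (homot_sym (homot_catA pf p1 pv)) _.
apply: homot_trans h0.
exact: homot_catl (is_path_cat pf p1) pv sq.
Qed.

(** By [cousin]: the property is additive in the interval, since generic conditions can be imposed
    together, and it holds locally because nearby divisors have labellings in a separating box. *)
Lemma path_pulls_to_hub L (f : I -> M) : triple_forbidden L -> continuous f ->
  (forall t, (range cell_map `&` D L) (f t)) -> generic (pulls_to_hub L f).
Proof.
move=> L3 cf Uf.
have -> : pulls_to_hub L f = pulls_to_hub L (subpath f 0 1) by rewrite subpath_full.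
pose Q a b := generic (pulls_to_hub L (subpath f a b)).
apply: (@cousin R Q) => [a b c _ _ Qab Qbc|t].
  have [[ua _ uaf] Da] := Uf (clamp a); have [[ub _ ubf] Db] := Uf (clamp b).
  have [[uc _ ucf] Dc] := Uf (clamp c).
  rewrite -uaf in Da; rewrite -ubf in Db; rewrite -ucf in Dc.
  have := generic_and (generic_and Qab Qbc) (generic_and (generic_segment_path Da)
    (generic_and (generic_segment_path Db) (generic_segment_path Dc))).
  apply: generic_imp => x [[hab hbc] [/(is_pathS (@subIsetr _ _ _)) pa
    [/(is_pathS (@subIsetr _ _ _)) pb /(is_pathS (@subIsetr _ _ _)) pc]]].
  have p r s := @is_path_subpath R M (D L) f r s cf (fun t => (Uf t).2).
  have [_ _ ab0 ab1] := p a b; have [_ _ bc0 bc1] := p b c; have [_ _ ac0 ac1] := p a c.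
  rewrite -uaf -ubf in ab0 ab1; rewrite -ubf -ucf in bc0 bc1; rewrite -uaf -ucf in ac0 ac1.
  apply: (@pulls_to_hubW _ _ _ ua uc) => //.
  have pab := p a b; have pbc := p b c; have pac := p a c.
  rewrite -uaf -ubf in pab; rewrite -ubf -ucf in pbc; rewrite -uaf -ucf in pac.
  have split_ac := homot_sym (homot_subpath_cat a b c cf (fun t => (Uf t).2)).
  apply: homot_trans (homot_catl pac pc split_ac) _.
  apply: homot_trans (homot_catA pab pbc pc) _.
  apply: homot_trans (hab ua ub _ _) => //.
  exact: homot_catr pab (is_path_cat pbc pc) (hbc ub uc _ _).
have [[v _ vf] Dt] := Uf t; rewrite -vf in Dt.
have [e e0 sep] := separating_box v.
have boxv j : nbhs (v j) (box e v j).
  by apply: open_nbhs_nbhs; split; [exact: box_open|rewrite /box /= !subrr normr0].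
have := cell_map_open boxv; rewrite vf.
have cfc : continuous (fun a : R^o => f (clamp a)) by exact: (cts_comp (@clamp_continuous R) cf).
rewrite -{1}[t]clamp_ival => /(cfc (ival t))/nbhs_ballP[d /= d0 dB].
exists (ball (ival t) d); first exact: nbhsx_ballx.
move=> a b _ _ _ ad bd; apply: (box_pulls_to_hub L3 e0 Dt sep).
  by have [] := @is_path_subpath R M setT f a b cf (fun=> Logic.I).
move=> r; apply: dB; rewrite /ball /= in ad bd *.
have /andP[r0 r1] := ival_itv r.
move: ad bd; rewrite !ltr_norml => /andP[a1 a2] /andP[b1 b2].
(* The parameter of the subpath is a convex combination of [a] and [b], hence stays within [d] of
   [ival t]. *)
have conv (X Y : R) : 0 < X -> 0 < Y -> 0 < (1 - ival r) * X + ival r * Y.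
  move=> X0 Y0; have [->|r_neq0] := eqVneq (ival r) 0; first by rewrite subr0 mul1r mul0r addr0.
  apply: ltr_wpDl; first by rewrite mulr_ge0 ?subr_ge0// ltW.
  by rewrite mulr_gt0// lt_neqAle eq_sym r_neq0.
apply/andP; split; rewrite -subr_gt0.
  have -> : ival t - (a + (b - a) * ival r) - - d =
    (1 - ival r) * (d + (ival t - a)) + ival r * (d + (ival t - b)) by ring.
  by apply: conv; lra.
have -> : d - (ival t - (a + (b - a) * ival r)) =
  (1 - ival r) * (d - (ival t - a)) + ival r * (d - (ival t - b)) by ring.
by apply: conv; lra.
Qed.

(** For a hub generic for both paths, [f] and [g] followed by the same segment to the hub are
    homotopic to the same segment; cancel the common end. *)
Lemma cell_unique_paths L : triple_forbidden L ->
  unique_paths R (range cell_map `&` D L) (D L).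
Proof.
move=> L3 f g x y [cf Uf f0 f1] [cg Ug g0 g1].
have [[u _ uf] Du] := Uf zero; have [[v _ vf] Dv] := Uf one.
rewrite -uf in Du; rewrite -vf in Dv.
have [h [[hf hg] [pu' pv']]] := generic_ex (generic_and
  (generic_and (path_pulls_to_hub L3 cf Uf) (path_pulls_to_hub L3 cg Ug))
  (generic_and (generic_segment_path Du) (generic_segment_path Dv))).
have pu := is_pathS (@subIsetr _ _ _) pu'; have pv := is_pathS (@subIsetr _ _ _) pv'.
have pf : is_path (D L) f (cell_map u) (cell_map v) by split=> // t; have [] := Uf t.
have pg : is_path (D L) g (cell_map u) (cell_map v).
  by split=> [//|t||]; [have [] := Ug t|rewrite uf f0|rewrite vf f1].
apply: (homot_cancelr pf pg pv); apply: homot_trans (hf u v _ _) _ => //.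
by apply: homot_sym; apply: hg; rewrite ?g0 ?g1 ?uf ?vf.
Qed.

End LocalCell.

(** * Bases of good cells *)

Section Assembly.
Context {R : realType} {V : finType} (k : V -> nat) (S : riemann_surface R).
Local Notation P := (R^o * R^o)%type.
Local Notation J := (point_index k).
Local Notation M := (sympow_prod k S).
Local Notation D L := (@braiding_divisors V k S L).

(** Charts are chosen per point of the surface rather than per label, so labels at the same point
    share their chart; the Hausdorff property makes the discs at different points disjoint. *)
Lemma adapted_charts (z0 : J -> S) (O : set M) : nbhs (divisor z0) O ->
  exists psi : J -> P -> S, [/\ forall j, planar_chart (z0 j) (psi j),
    forall i j, z0 i = z0 j -> psi i = psi j,
    forall i j x y, psi i x = psi j y -> z0 i = z0 j &
    forall v, O (cell_map psi v)].
Proof.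
move=> nO; have [N nN NO] := divisor_nbhs nO.
have /choice[AB HAB] : forall ij : J * J, exists AB : set S * set S,
    [/\ nbhs (z0 ij.1) AB.1, nbhs (z0 ij.2) AB.2 &
     forall x, AB.1 x -> AB.2 x -> z0 ij.1 = z0 ij.2].
  move=> [i j] /=; have [zij|/eqP zij] := pselect (z0 i = z0 j).
    by exists (setT, setT); split=> //; exact: filterT.
  have := @rs_hausdorff _ S; rewrite open_hausdorff => /(_ _ _ zij).
  move=> [[A B] /= [/set_mem Ai /set_mem Bj] [oA oB /eqP AB0]].
  exists (A, B); split=> /=; [exact: open_nbhs_nbhs|exact: open_nbhs_nbhs|].
  by move=> x Ax Bx; have : (A `&` B) x by []; rewrite AB0.
(* All constraints imposed by the labels located at [p], namely closeness and separation from every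
   other label at a different point. *)
pose U p : set S := [set x | forall i, z0 i = p ->
  N i x /\ forall j, (AB (i, j)).1 x /\ (AB (j, i)).2 x].
have nU p : nbhs p (U p).
  apply: (@filter_forall _ _ _ (nbhs p) (nbhs_filter p)) => i.
  have [zip|zip] := pselect (z0 i = p); last by apply: nearW => x /zip.
  suff : nbhs p [set x | N i x /\ forall j, (AB (i, j)).1 x /\ (AB (j, i)).2 x].
    by apply: (@filterS _ (nbhs p) (nbhs_filter p)) => x Hx _.
  rewrite -zip; apply: filterI; first exact: nN.
  apply: (@filter_forall _ _ _ (nbhs (z0 i)) (nbhs_filter _)) => j.
  by apply: filterI; [have [] := HAB (i, j)|have [] := HAB (j, i)].
have /choice[psi Hpsi] : forall p, exists psi : P -> S, planar_chart p psi /\ range psi `<=` U p.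
  by move=> p; have [psi ? ?] := planar_chart_exists (nU p); exists psi.
exists (fun j => psi (z0 j)); split.
- by move=> j; have [] := Hpsi (z0 j).
- by move=> i j ->.
- move=> i j x y xy; have [_ Ui] := Hpsi (z0 i); have [_ Uj] := Hpsi (z0 j).
  have [_ /(_ j)[Aq _]] := Ui _ (imageT _ x) i erefl.
  have [_ /(_ i)[_ Bq]] := Uj _ (imageT _ y) j erefl.
  by have [_ _] := HAB (i, j); apply; [exact: Aq|rewrite xy].
- move=> v; apply: NO => j; have [_ Uj] := Hpsi (z0 j).
  by have [] := Uj _ (imageT _ (v j)) j erefl.
Qed.

Lemma cell_map0 (z0 : J -> S) (psi : J -> P -> S) :
  (forall j, planar_chart (z0 j) (psi j)) -> cell_map psi (fun=> (0, 0)) = divisor z0.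
Proof.
by move=> Hpsi; congr divisor; apply/funext => j; have [] := Hpsi j.
Qed.

(** The centre of the cell may be any divisor, braiding or not: this is what connects the braiding
    divisors inside the whole product. *)
Lemma dense_cells L : local_basis setT (dense_cell R (D L)).
Proof.
move=> x O _; have [z0 <-] := divisor_surj x => nO.
have [psi [chart eq disj inO]] := adapted_charts nO.
exists (range (cell_map psi)); split; last by move=> _ [v _ <-].
  have [ne pc] := cell_dense chart eq disj L.
  by split=> //; exact: (cell_open chart).
by exists (fun=> (0, 0)) => //; exact: cell_map0.
Qed.

Lemma braiding_sk1 L : D (sk1 L) `<=` D L.
Proof.
move=> d Dd s s0 sL; apply: Dd => //.
by rewrite inE negb_and sL.
Qed.

(** Near a divisor braiding by [L] no coincidence forbidden by [L] can occur, so the condition on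
    triples is vacuous for [L]. For the 1-skeleton, a forbidden set of at most two colours is
    already forbidden by [L], hence only sets of three or more remain. *)
Lemma good_cells L : local_basis (D L) (good_cell R (D L) (D (sk1 L))).
Proof.
move=> x O; have [z0 <-] := divisor_surj x => Dz0 nO.
have [psi [chart eq disj inO]] := adapted_charts nO.
exists (range (cell_map psi)); split; last by move=> _ [v _ <-].
  have [ne pc] := cell_dense chart eq disj (sk1 L).
  have [_ pcL] := cell_dense chart eq disj L.
  have noL (s : {set V}) (f : V -> J) : s != finset.set0 -> s \notin simplices L ->
      (forall w, w \in s -> tag (f w) = w) ->
      (forall w w', w \in s -> w' \in s -> z0 (f w) = z0 (f w')) -> False.
    by move=> s0 sL ft zf; exact: (braidingN s0 sL ft zf Dz0).
  split=> //; first by split=> //; exact: (cell_open chart).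
    apply: (cell_unique_paths chart eq disj) => s f s0 sL ft zf.
    by have := noL s f s0 sL ft zf.
  apply: (cell_unique_paths chart eq disj) => s f s0 sL ft zf.
  rewrite ltnNge; apply/negP => s2; apply: (noL s f s0 _ ft zf).
  by move: sL; rewrite inE s2 andbT.
by exists (fun=> (0, 0)) => //; exact: cell_map0.
Qed.

Lemma sympow_prod_path_connected : connected [set: S] -> path_connected R [set: M].
Proof.
move=> /riemann_surface_path_connected Spc x y _ _.
have [z <-] := divisor_surj x; have [z' <-] := divisor_surj y.
have /choice[g Hg] : forall j, exists g : unit_interval R -> S, is_path setT g (z j) (z' j).
  by move=> j; exact: Spc.
exists (fun t => divisor (fun j => g j t)); split=> //.
- by apply: divisor_continuous => j; have [] := Hg j.
- by congr divisor; apply/funext => j; have [] := Hg j.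
- by congr divisor; apply/funext => j; have [] := Hg j.
Qed.

End Assembly.

Theorem proposition8 (R : realType) (Sigma : riemann_surface R)
    (Sigma_connected : connected [set: Sigma])
    (V : finType) (C : colour_scheme V)
    (d : div_plus (cs_mult C) Sigma (cs_complex C))
    (e : div_plus (cs_mult C) Sigma (sk1 (cs_complex C))) :
  group_isomorphic (pi1 R d) (pi1 R e).
Proof.
have Mpc := @sympow_prod_path_connected R V (cs_mult C) Sigma Sigma_connected.
apply: pi1_isomorphic.
- exact: good_cells.
- exact: braiding_sk1.
- by apply: path_connected_dense Mpc => //; exact: dense_cells.
Qed.
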